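(* There are algorithms with the following guarantees, where the input consists of a finite domain $\mathcal{X}$, the probability mass function of a distribution $\mathcal{D}$ over $\mathcal{X}\times\{0,1\}$, and the table of values of a predictor $f:\mathcal{X}\to[0,1]$: (1) If $\mathcal{D}$ is both uniform and noiseless, $\mathsf{CalDist}_{\mathcal{D}}(f)$ can be computed exactly in $O(|\mathcal{X}|^4)$ time. (2) If $\mathcal{D}$ is uniform, then for every $\epsilon>0$, a number within additive error $\epsilon$ of $\mathsf{CalDist}_{\mathcal{D}}(f)$ can be computed in $|\mathcal{X}|^{O(1/\epsilon)}$ time. (3) For general $\mathcal{D}$, for every $\epsilon>0$, a number within additive error $\epsilon$ of $\mathsf{CalDist}_{\mathcal{D}}(f)$ can be computed in $(|\mathcal{X}|/\epsilon)^{O(1/\epsilon)}$ time.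
   Context: Let $\mathcal{X}$ be a finite set and $\mathcal{D}$ a distribution over $\mathcal{X}\times\{0,1\}$ with $\mathcal{X}$-marginal $\mathcal{D}_x$. For $x\in\mathcal{X}$, $\mu_{\mathcal{D}}(x)=\Pr_{(x',y)\sim\mathcal{D}}[y=1\mid x'=x]$ (set to $0$ if $\mathcal{D}_x(x)=0$). $\mathcal{D}$ is uniform if $\mathcal{D}_x$ is uniform on $\mathcal{X}$, and noiseless if $\mu_{\mathcal{D}}(x)\in\{0,1\}$ for all $x$. A predictor $g:\mathcal{X}\to[0,1]$ is perfectly calibrated w.r.t. $\mathcal{D}$ if for every $\alpha\in[0,1]$ with $\Pr_{(x,y)\sim\mathcal{D}}[g(x)=\alpha]>0$ we have $\Pr_{(x,y)\sim\mathcal{D}}[y=1\mid g(x)=\alpha]=\alpha$; $\mathcal{C}(\mathcal{D})$ is the set of such predictors. $d_{\mathcal{D}}(f,g)=\mathbb{E}_{x\sim\mathcal{D}_x}|f(x)-g(x)|$ and $\mathsf{CalDist}_{\mathcal{D}}(f)=\inf_{g\in\mathcal{C}(\mathcal{D})}d_{\mathcal{D}}(f,g)$. Running times are in the real RAM model (inputs are exact reals; each arithmetic operation or comparison costs unit time); the constants in the $O(\cdot)$ are absolute. *)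

(* Defs.v *)
From HB Require Import structures.
From mathcomp Require Import all_boot all_order all_algebra.
From mathcomp Require Import boolp classical_sets reals exp.

Set Implicit Arguments.
Unset Strict Implicit.
Unset Printing Implicit Defensive.

Import Order.TTheory GRing.Theory Num.Theory.
Local Open Scope ring_scope.

Section Calibration.
Variable R : realType.

Record fdist (T : finType) := FDist {
  pmf :> {ffun T -> R};
  pmf_ge0 : forall t, 0 <= pmf t;
  pmf_sum1 : \sum_t pmf t = 1 }.

Definition Pr (T : finType) (P : fdist T) (A : pred T) : R := \sum_(t | A t) P t.

(* This is 0 when [Pr P B = 0], because [x / 0 = 0]. *)
Definition cPr (T : finType) (P : fdist T) (A B : pred T) : R :=
  Pr P (predI A B) / Pr P B.

Variables (X : finType) (D : fdist (X * bool)%type).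

(* In [z : X * bool], the label [z.2 = true] stands for y = 1. *)
Definition marginal (x : X) : R := Pr D [pred z | z.1 == x].

Definition mu (x : X) : R := cPr D [pred z | z.2] [pred z | z.1 == x].

Definition uniform : Prop := forall x, marginal x = #|X|%:R^-1.

Definition noiseless : Prop := forall x, mu x = 0 \/ mu x = 1.

Definition predictor (g : X -> R) : Prop := forall x, 0 <= g x <= 1.

Definition calibrated (g : X -> R) : Prop :=
  predictor g /\
  forall alpha : R, 0 <= alpha <= 1 ->
    0 < Pr D [pred z | g z.1 == alpha] ->
    cPr D [pred z | z.2] [pred z | g z.1 == alpha] = alpha.

Definition dist (f g : X -> R) : R := \sum_x marginal x * `|f x - g x|.

Definition CalDist (f : X -> R) : R :=
  inf [set dist f g | g in [set g | calibrated g]]%classic.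

End Calibration.

(* The real RAM: a memory of natural-number cells, used for counters and
   addresses, and a memory of exact real cells, both indirectly addressable.
   Naturals can be cast to reals, but there is no floor and no conversion from
   reals to naturals, and programs contain no real constants.  Programs are
   structured (while programs) instead of lists of jumps. *)

Inductive iexp :=
  | IConst of nat
  | ICell of iexp
  | IAdd of iexp & iexp
  | ISub of iexp & iexp
  | IMul of iexp & iexp.

Inductive rexp :=
  | RCast of iexp
  | RCell of iexp
  | RAdd of rexp & rexp
  | RSub of rexp & rexp
  | RMul of rexp & rexp
  | RDiv of rexp & rexp.

Inductive bexp :=
  | BLeI of iexp & iexp
  | BLeR of rexp & rexp
  | BNot of bexp
  | BAnd of bexp & bexp.

Inductive cmd :=
  | Skip
  | ISet of iexp & iexp
  | RSet of iexp & rexp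
  | Seq of cmd & cmd
  | If of bexp & cmd & cmd
  | While of bexp & cmd.

(* Every constant, memory access, cast, arithmetic operation, comparison and
   connective costs one unit. *)
Fixpoint icost (e : iexp) : nat :=
  match e with
  | IConst _ => 1
  | ICell a => (icost a).+1
  | IAdd a b | ISub a b | IMul a b => (icost a + icost b).+1
  end.

Fixpoint rcost (e : rexp) : nat :=
  match e with
  | RCast a | RCell a => (icost a).+1
  | RAdd a b | RSub a b | RMul a b | RDiv a b => (rcost a + rcost b).+1
  end.

Fixpoint bcost (e : bexp) : nat :=
  match e with
  | BLeI a b => (icost a + icost b).+1
  | BLeR a b => (rcost a + rcost b).+1
  | BNot a => (bcost a).+1
  | BAnd a b => (bcost a + bcost b).+1
  end.

Section Semantics.
Variable R : realType.

Record state := State { imem : nat -> nat; rmem : nat -> R }.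

(* Subtraction of naturals is truncated. *)
Fixpoint ieval (s : state) (e : iexp) : nat :=
  match e with
  | IConst k => k
  | ICell a => imem s (ieval s a)
  | IAdd a b => (ieval s a + ieval s b)%N
  | ISub a b => (ieval s a - ieval s b)%N
  | IMul a b => (ieval s a * ieval s b)%N
  end.

(* Division by zero returns 0. *)
Fixpoint reval (s : state) (e : rexp) : R :=
  match e with
  | RCast a => (ieval s a)%:R
  | RCell a => rmem s (ieval s a)
  | RAdd a b => reval s a + reval s b
  | RSub a b => reval s a - reval s b
  | RMul a b => reval s a * reval s b
  | RDiv a b => reval s a / reval s b
  end.

Fixpoint beval (s : state) (e : bexp) : bool :=
  match e with
  | BLeI a b => (ieval s a <= ieval s b)%N
  | BLeR a b => reval s a <= reval s b
  | BNot a => ~~ beval s a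
  | BAnd a b => beval s a && beval s b
  end.

Definition upd (T : Type) (m : nat -> T) (a : nat) (v : T) : nat -> T :=
  fun k => if k == a then v else m k.

(* [exec c s t s']: started in [s], [c] halts in [s'] after [t] units of time. *)
Inductive exec : cmd -> state -> nat -> state -> Prop :=
  | ExecSkip s : exec Skip s 1 s
  | ExecISet a e s :
      exec (ISet a e) s (icost a + icost e).+1
        (State (upd (imem s) (ieval s a) (ieval s e)) (rmem s))
  | ExecRSet a e s :
      exec (RSet a e) s (icost a + rcost e).+1
        (State (imem s) (upd (rmem s) (ieval s a) (reval s e)))
  | ExecSeq c1 c2 s t1 s1 t2 s2 :
      exec c1 s t1 s1 -> exec c2 s1 t2 s2 ->
      exec (Seq c1 c2) s (t1 + t2) s2
  | ExecIfTrue b c1 c2 s t s' :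
      beval s b -> exec c1 s t s' ->
      exec (If b c1 c2) s (bcost b + t).+1 s'
  | ExecIfFalse b c1 c2 s t s' :
      ~~ beval s b -> exec c2 s t s' ->
      exec (If b c1 c2) s (bcost b + t).+1 s'
  | ExecWhileFalse b c s :
      ~~ beval s b -> exec (While b c) s (bcost b).+1 s
  | ExecWhileTrue b c s t1 s1 t2 s2 :
      beval s b -> exec c s t1 s1 -> exec (While b c) s1 t2 s2 ->
      exec (While b c) s ((bcost b + t1).+1 + t2) s2.

(* Natural cell 0 holds |X|.  With n = |X| and X enumerated as x_0, ...,
   x_(n-1), the real cells hold D(x_i, 0) at i, D(x_i, 1) at n + i, f(x_i) at
   2n + i, and the further parameters from 3n on.  All other cells are 0. *)
Definition input (X : finType) (D : fdist R (X * bool)%type) (f : X -> R)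
    (params : seq R) : state :=
  State (fun k => if k == 0%N then #|X| else 0%N)
        (nth 0 ([seq D (x, false) | x <- enum X] ++
                [seq D (x, true) | x <- enum X] ++
                [seq f x | x <- enum X] ++ params)).

(* The output is read off real cell 0. *)
Definition computes_in (c : cmd) (s : state) (t : nat) (v : R) : Prop :=
  exists2 s' : state, exec c s t s' & rmem s' 0%N = v.

End Semantics.

(* Main.v *)
Require Import Defs.
From mathcomp Require Import all_boot all_order all_algebra fingroup perm.
From mathcomp Require Import boolp classical_sets reals exp.
From mathcomp Require Import zify ring lra.

Set Implicit Arguments.
Unset Strict Implicit.
Unset Printing Implicit Defensive.

Import Order.TTheory GRing.Theory Num.Theory.
Local Open Scope ring_scope.

(* Replacing a calibrated predictor by the means of its level sets shows that
   CalDist is a minimum over partitions of X, each block being assigned the mean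
   of mu over it.

   (1) In the uniform noiseless case only the numbers of 0- and 1-labels in the
   blocks matter for calibration.  By an exchange argument the values can be
   taken monotone in f inside each label class, so a block consists of a segment
   of the sorted 1-points and a segment of the sorted 0-points.  A dynamic
   program over pairs of segment ends, with O(n^2) transitions per pair and
   precomputed prefix costs, finds the optimum in O(n^4).

   (2), (3) If eps >= 1, output 0.  If n eps < 1, try all n^n assignments of
   points to blocks.  Otherwise round the values of a calibrated g to multiples
   of 1/K with K about 3/eps.  With a_x/K the rounded value at x, the distance is
   up to O(eps) the cost sum_x D_x |f(x) - a_x/K| plus the sum over the K + 1
   levels of the calibration error.  That error depends only on the 0-mass and
   1-mass of a level, up to O(eps) on integer roundings at scale 1/(nK), so the
   vector of all these masses is the state of a dynamic program with
   (nK + 1)^(2(K + 1)) states.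

   The programs are written in a language of bounded loops: the running time is
   then a polynomial, of degree the nesting depth, in a common bound on the
   numbers of rounds. *)

(** * Bounded loop programs and their compilation *)

(** The machine has no floor and no integer division, and only naturals serve as addresses. A table
    can be indexed by masses only after these have been rounded to integers by counting loops, and
    each rounding is charged to the error: [1/K] for moving the values of g, [1/K] for the
    calibration error this creates, and [n/M] for the floors of the masses. With M = nK the sum is
    [3/K], which is at most eps. The dynamic program never needs the mean of a level, since moving
    level [j/K] to its true mean costs exactly its calibration error.

    The case split comes from (2), where the time must be n to the power O(1/eps). If n eps >= 1,
    then K <= 3n, and for n >= 2 the base nK + 1 is at most n^4. If n eps < 1, then K can exceed any
    fixed power of n, but n < 1/eps bounds the exponent of n^n. If eps >= 1, the allowed time may be
    constant, so the input cannot even be read in full. *)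

Inductive nexp :=
  | NC of nat
  | NV of nat
  | NAdd of nexp & nexp
  | NSub of nexp & nexp
  | NMul of nexp & nexp.

Inductive xexp :=
  | XN of nexp
  | XR of nat & nexp
  | XAdd of xexp & xexp
  | XSub of xexp & xexp
  | XMul of xexp & xexp
  | XDiv of xexp & xexp.

Inductive cexp :=
  | CLeN of nexp & nexp
  | CLeX of xexp & xexp
  | CNot of cexp
  | CAnd of cexp & cexp.

Inductive prog :=
  | PSkip
  | PSetN of nat & nexp
  | PSetX of nat & nexp & xexp
  | PSeq of prog & prog
  | PIf of cexp & prog & prog
  | PFor of nat & nexp & prog.

(* Variable [x] lives in natural cell [2x]; cell [2x + 1] holds the bound of a
   loop over [x].  Entry [i] of real array [r < 8] lives in real cell
   [3n + 1 + 8i + r], above the input. *)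
Fixpoint cn (e : nexp) : iexp :=
  match e with
  | NC k => IConst k
  | NV x => ICell (IConst x.*2)
  | NAdd a b => IAdd (cn a) (cn b)
  | NSub a b => ISub (cn a) (cn b)
  | NMul a b => IMul (cn a) (cn b)
  end.

Definition address (r : nat) (e : iexp) : iexp :=
  IAdd (IAdd (IMul (IConst 3) (ICell (IConst 0))) (IConst 1))
       (IAdd (IMul (IConst 8) e) (IConst r)).

Fixpoint cx (e : xexp) : rexp :=
  match e with
  | XN a => RCast (cn a)
  | XR r a => RCell (address r (cn a))
  | XAdd a b => RAdd (cx a) (cx b)
  | XSub a b => RSub (cx a) (cx b)
  | XMul a b => RMul (cx a) (cx b)
  | XDiv a b => RDiv (cx a) (cx b)
  end.

Fixpoint cc (e : cexp) : bexp :=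
  match e with
  | CLeN a b => BLeI (cn a) (cn b)
  | CLeX a b => BLeR (cx a) (cx b)
  | CNot a => BNot (cc a)
  | CAnd a b => BAnd (cc a) (cc b)
  end.

(** The bound is evaluated once and kept in its own cell, so a body that changes the variables of
    [e] does not change the number of rounds. *)
Definition for_loop (x : nat) (e : iexp) (body : cmd) : cmd :=
  Seq (ISet (IConst x.*2.+1) e)
  (Seq (ISet (IConst x.*2) (IConst 0))
       (While (BNot (BLeI (ICell (IConst x.*2.+1)) (ICell (IConst x.*2))))
          (Seq body
             (ISet (IConst x.*2) (IAdd (ICell (IConst x.*2)) (IConst 1)))))).

Fixpoint compile (p : prog) : cmd :=
  match p with
  | PSkip => Skip
  | PSetN x e => ISet (IConst x.*2) (cn e)
  | PSetX r i e => RSet (address r (cn i)) (cx e)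
  | PSeq p q => Seq (compile p) (compile q)
  | PIf b p q => If (cc b) (compile p) (compile q)
  | PFor x e p => for_loop x (cn e) (compile p)
  end.

Fixpoint nwrites (p : prog) : seq nat :=
  match p with
  | PSkip | PSetX _ _ _ => [::]
  | PSetN x _ => [:: x]
  | PSeq p q | PIf _ p q => nwrites p ++ nwrites q
  | PFor x _ p => x :: nwrites p
  end.

Fixpoint xwrites (p : prog) : seq nat :=
  match p with
  | PSkip | PSetN _ _ => [::]
  | PSetX r _ _ => [:: r]
  | PSeq p q | PIf _ p q => xwrites p ++ xwrites q
  | PFor _ _ p => xwrites p
  end.

Fixpoint wfx (e : xexp) : bool :=
  match e with
  | XN _ => true
  | XR r _ => (r < 8)%N
  | XAdd a b | XSub a b | XMul a b | XDiv a b => wfx a && wfx b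
  end.

Fixpoint wfc (e : cexp) : bool :=
  match e with
  | CLeN _ _ => true
  | CLeX a b => wfx a && wfx b
  | CNot a => wfc a
  | CAnd a b => wfc a && wfc b
  end.

(** Variable 0 holds n, on which every array address depends, so it is never written. A body that
    wrote its own loop counter would spoil the number of rounds. *)
Fixpoint wf (p : prog) : bool :=
  match p with
  | PSkip => true
  | PSetN x _ => x != 0%N
  | PSetX r _ e => (r < 8)%N && wfx e
  | PSeq p q => wf p && wf q
  | PIf b p q => [&& wfc b, wf p & wf q]
  | PFor x _ p => [&& x != 0%N, x \notin nwrites p & wf p]
  end.

Fixpoint depth (p : prog) : nat :=
  match p with
  | PSkip | PSetN _ _ | PSetX _ _ _ => 0
  | PSeq p q | PIf _ p q => maxn (depth p) (depth q)
  | PFor _ _ p => (depth p).+1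
  end.

(* A bound on the running time when no loop makes more than [M] rounds. *)
Fixpoint tbound (M : nat) (p : prog) : nat :=
  match p with
  | PSkip => 1
  | PSetN x e => (icost (cn e)).+2
  | PSetX r i e => (icost (address r (cn i)) + rcost (cx e)).+1
  | PSeq p q => tbound M p + tbound M q
  | PIf b p q => (bcost (cc b) + (tbound M p + tbound M q)).+1
  | PFor x e p => icost (cn e) + 20 + M * (tbound M p + 20)
  end.

(** Nesting multiplies by [M] while sequencing only adds, so the exponent is the loop depth and the
    coefficient is the bound for loops of a single round. *)
Lemma tbound_poly M p : (0 < M)%N -> (tbound M p <= tbound 1 p * M ^ depth p)%N.
Proof.
move=> M0; elim: p => //=.
- by move=> *; rewrite expn0 muln1.
- by move=> *; rewrite expn0 muln1.
- move=> p hp q hq; rewrite mulnDl; apply: leq_add.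
    by apply: (leq_trans hp); rewrite leq_mul2l leq_pexp2l ?orbT ?leq_maxl.
  by apply: (leq_trans hq); rewrite leq_mul2l leq_pexp2l ?orbT ?leq_maxr.
- move=> b p hp q hq; rewrite -!addSn mulnDl; apply: leq_add.
    by rewrite leq_pmulr // expn_gt0 M0.
  rewrite mulnDl; apply: leq_add.
    by apply: (leq_trans hp); rewrite leq_mul2l leq_pexp2l ?orbT ?leq_maxl.
  by apply: (leq_trans hq); rewrite leq_mul2l leq_pexp2l ?orbT ?leq_maxr.
- move=> x e p hp; rewrite mul1n mulnDl; apply: leq_add.
    by rewrite leq_pmulr // expn_gt0 M0.
  rewrite expnS mulnCA leq_mul2l mulnDl; apply/orP; right; apply: leq_add => //.
  by rewrite leq_pmulr // expn_gt0 M0.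
Qed.

(** * Abstract states, weakest preconditions and their soundness for the machine *)

Section ProgramLogic.
Variable R : realType.

Record astate := AState { nv : nat -> nat; xr : nat -> nat -> R }.

(** Variables and array names are numerals, and [eqn] on numerals computes away under
    simplification; array indices are symbolic and are compared with [==]. *)
Definition setn (a : astate) (x k : nat) : astate :=
  AState (fun y => if eqn y x then k else nv a y) (xr a).

Definition setx (a : astate) (r i : nat) (v : R) : astate :=
  AState (nv a) (fun r' i' =>
    if eqn r' r then (if i' == i then v else xr a r' i') else xr a r' i').

Fixpoint neval (a : astate) (e : nexp) : nat :=
  match e with
  | NC k => k
  | NV x => nv a x
  | NAdd e1 e2 => (neval a e1 + neval a e2)%N
  | NSub e1 e2 => (neval a e1 - neval a e2)%N
  | NMul e1 e2 => (neval a e1 * neval a e2)%N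
  end.

Fixpoint xeval (a : astate) (e : xexp) : R :=
  match e with
  | XN e => (neval a e)%:R
  | XR r e => xr a r (neval a e)
  | XAdd e1 e2 => xeval a e1 + xeval a e2
  | XSub e1 e2 => xeval a e1 - xeval a e2
  | XMul e1 e2 => xeval a e1 * xeval a e2
  | XDiv e1 e2 => xeval a e1 / xeval a e2
  end.

Fixpoint ceval (a : astate) (e : cexp) : bool :=
  match e with
  | CLeN e1 e2 => (neval a e1 <= neval a e2)%N
  | CLeX e1 e2 => xeval a e1 <= xeval a e2
  | CNot e => ~~ ceval a e
  | CAnd e1 e2 => ceval a e1 && ceval a e2
  end.

Definition frame (p : prog) (a a' : astate) : Prop :=
  (forall x, x \notin nwrites p -> nv a' x = nv a x) /\
  (forall r, r \notin xwrites p -> xr a' r = xr a r).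

(** Only loops need an invariant. It comes with the frame of the whole loop, so it need not mention
    what the loop leaves alone, and the counter is set from outside, so it need not mention the
    counter either. [M] bounds the rounds of every loop. *)
Fixpoint wp (M : nat) (p : prog) (Q : astate -> Prop) (a : astate) : Prop :=
  match p with
  | PSkip => Q a
  | PSetN x e => Q (setn a x (neval a e))
  | PSetX r i e => Q (setx a r (neval a i) (xeval a e))
  | PSeq p q => wp M p (wp M q Q) a
  | PIf b p q => if ceval a b then wp M p Q a else wp M q Q a
  | PFor x e p => (neval a e <= M)%N /\ exists Inv : nat -> astate -> Prop,
      [/\ Inv 0%N a,
          forall k a', (k < neval a e)%N -> frame (PFor x e p) a a' ->
            Inv k a' -> wp M p (Inv k.+1) (setn a' x k)
        & forall a', frame (PFor x e p) a a' -> Inv (neval a e) a' ->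
            Q (setn a' x (neval a e))]
  end.

(** The odd natural cells, which hold loop bounds, and the real cells up to 3n, which held the
    input, are left unconstrained. *)
Definition sim (n : nat) (a : astate) (s : state R) : Prop :=
  [/\ nv a 0%N = n,
      forall x, imem s x.*2 = nv a x
    & forall r i, (r < 8)%N ->
        rmem s (3 * n + 1 + (8 * i + r))%N = xr a r i].

Lemma frame_trans p a b c : frame p a b -> frame p b c -> frame p a c.
Proof.
move=> [h1 h2] [h3 h4]; split=> x hx; first by rewrite h3 ?h1.
by rewrite h4 ?h2.
Qed.

Lemma frame_sub p q a b :
  {subset nwrites q <= nwrites p} -> {subset xwrites q <= xwrites p} ->
  frame q a b -> frame p a b.
Proof.
move=> s1 s2 [h1 h2]; split=> x hx.
  by rewrite h1 //; apply: contra hx => /s1.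
by rewrite h2 //; apply: contra hx => /s2.
Qed.

Lemma setn_frame p a x k : x \in nwrites p -> frame p a (setn a x k).
Proof.
move=> xp; split=> // y yp /=; case: (@eqnP y x) => // yx.
by rewrite yx xp in yp.
Qed.

Lemma setx_frame p a r i v : r \in xwrites p -> frame p a (setx a r i v).
Proof.
move=> xp; split=> // y yp /=; apply: funext => j.
by case: (@eqnP y r) => // yx; rewrite yx xp in yp.
Qed.

(** The consequence rule, with the frame of [p] as an extra premise; facts about unwritten variables
    and arrays cross a subprogram by it. *)
Lemma wp_frame M p P Q a :
  wp M p P a -> (forall a', frame p a a' -> P a' -> Q a') -> wp M p Q a.
Proof.
elim: p P Q a => [|x e|r i e|p hp q hq|b p hp q hq|x e p hp] P Q a /=.
- by move=> h; apply.
- by move=> h; apply=> //; apply: setn_frame; rewrite inE.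
- by move=> h; apply=> //; apply: setx_frame; rewrite inE.
- move=> h hQ; apply: (hp _ _ _ h) => a1 f1 h1; apply: (hq _ _ _ h1) => a2 f2 h2.
  apply: hQ h2; apply: (@frame_trans _ _ a1).
    by apply: frame_sub f1 => z hz; rewrite mem_cat hz.
  by apply: frame_sub f2 => z hz; rewrite mem_cat hz orbT.
- case: ifP => _ h hQ.
    apply: (hp _ _ _ h) => a1 f1; apply: hQ.
    by apply: frame_sub f1 => z hz; rewrite mem_cat hz.
  apply: (hq _ _ _ h) => a1 f1; apply: hQ.
  by apply: frame_sub f1 => z hz; rewrite mem_cat hz orbT.
- move=> [leM [Inv [I0 IS IN]]] hQ; split=> //; exists Inv; split=> //.
  move=> a' fa hI; apply: hQ; last exact: IN.
  apply: (frame_trans fa); apply: setn_frame; exact: mem_head.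
Qed.

Lemma simE n a s : sim n a s ->
  [/\ forall e, ieval s (cn e) = neval a e,
      forall e, wfx e -> reval s (cx e) = xeval a e
    & forall e, wfc e -> beval s (cc e) = ceval a e].
Proof.
move=> [n0 hn hx].
have h1 e : ieval s (cn e) = neval a e.
  by elim: e => //= [e1 -> e2 ->|e1 -> e2 ->|e1 -> e2 ->].
have h2 e : wfx e -> reval s (cx e) = xeval a e.
  elim: e => //= [e _|r e hr|e1 h1' e2 h2'|e1 h1' e2 h2'|e1 h1' e2 h2'|e1 h1' e2 h2'].
  - by rewrite h1.
  - by rewrite h1 -(hx _ _ hr) (hn 0%N) n0.
  - by move=> /andP[/h1'-> /h2'->].
  - by move=> /andP[/h1'-> /h2'->].
  - by move=> /andP[/h1'-> /h2'->].
  - by move=> /andP[/h1'-> /h2'->].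
split=> //; elim=> //= [e1 e2 _|e1 e2 /andP[w1 w2]|e1 h|e1 h3 e2 h4].
- by rewrite !h1.
- by rewrite !h2.
- by move=> /h->.
- by move=> /andP[/h3-> /h4->].
Qed.

Lemma exec_for x e body s N T (Inv : nat -> state R -> Prop) :
  ieval s e = N ->
  Inv 0%N (State (upd (upd (imem s) x.*2.+1 N) x.*2 0%N) (rmem s)) ->
  (forall k s, (k < N)%N -> Inv k s ->
     imem s x.*2 = k -> imem s x.*2.+1 = N ->
     exists t s', [/\ exec body s t s', (t <= T)%N, imem s' x.*2 = k,
       imem s' x.*2.+1 = N & Inv k.+1 (State (upd (imem s') x.*2 k.+1) (rmem s'))]) ->
  exists t s', [/\ exec (for_loop x e body) s t s',
    (t <= icost e + 20 + N * (T + 20))%N, imem s' x.*2 = N & Inv N s'].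
Proof.
move=> eN I0 IS.
set s0 := State _ _ in I0.
set W := While (BNot (BLeI (ICell (IConst x.*2.+1)) (ICell (IConst x.*2))))
          (Seq body (ISet (IConst x.*2) (IAdd (ICell (IConst x.*2)) (IConst 1)))).
(* Induction on the number [d] of rounds still to be made. *)
suff main d k s1 : (k + d = N)%N -> Inv k s1 -> imem s1 x.*2 = k ->
    imem s1 x.*2.+1 = N ->
    exists t s', [/\ exec W s1 t s', (t <= 10 + d * (T + 20))%N,
      imem s' x.*2 = N & Inv N s'].
  have [|||t [s' [ex ht h1 h2]]] := main N 0%N s0 _ I0; rewrite //= ?/upd ?eqxx //.
    by have -> : (x.*2.+1 == x.*2) = false by lia.
  exists ((1 + icost e).+1 + ((1 + 1).+1 + t))%N, s'; split=> //; last by lia.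
  apply: (ExecSeq (ExecISet _ _ _)); apply: (ExecSeq (ExecISet _ _ _)).
  by rewrite /= eN.
elim: d k s1 => [|d IH] k s1 kN Ik xk xN.
  exists 7%N, s1; rewrite -{2}kN addn0; split=> //; last by rewrite xk -kN addn0.
  by apply: (ExecWhileFalse); rewrite /= negbK xk xN -kN addn0.
have ltkN : (k < N)%N by lia.
have [t1 [s2 [ex1 ht1 xk2 xN2 I2]]] := IS k s1 ltkN Ik xk xN.
have [| | |t2 [s3 [ex2 ht2 xk3 I3]]] := IH k.+1 _ _ I2.
- by lia.
- by rewrite /= /upd eqxx.
- by rewrite /= /upd; have -> : (x.*2.+1 == x.*2) = false by lia.
exists (((bcost (BNot (BLeI (ICell (IConst x.*2.+1)) (ICell (IConst x.*2))))) +
   (t1 + (1 + icost (IAdd (ICell (IConst x.*2)) (IConst 1))).+1)).+1 + t2)%N, s3.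
split=> //=; last by nia.
apply: ExecWhileTrue ex2; first by rewrite /= xk xN -ltnNge.
apply: (ExecSeq ex1).
have := ExecISet (IConst x.*2) (IAdd (ICell (IConst x.*2)) (IConst 1)) s2.
by rewrite /= xk2 (addn1 k).
Qed.

Lemma sim_setn n a s x k : x != 0%N -> sim n a s ->
  sim n (setn a x k) (State (upd (imem s) x.*2 k) (rmem s)).
Proof.
move=> x0 [n0 hn hx]; split=> //=; first by case: (x) x0.
move=> y; rewrite /upd; case: (@eqnP y x) => [->|yx]; first by rewrite eqxx.
have -> : (y.*2 == x.*2) = false by lia.
exact: hn.
Qed.

(** The clause on the cells [x.*2] and [x.*2.+1] strengthens the induction: loop bounds are
    invisible to [sim], and an enclosing loop needs its counter and its bound to survive the
    body. *)
Lemma wp_sound M n p Q a s : wf p -> wp M p Q a -> sim n a s ->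
  exists t s' a', [/\ exec (compile p) s t s', (t <= tbound M p)%N, sim n a' s',
    (forall x, x \notin nwrites p ->
       imem s' x.*2 = imem s x.*2 /\ imem s' x.*2.+1 = imem s x.*2.+1) & Q a'].
Proof.
elim: p Q a s => [|x e|r i e|p hp q hq|b p hp q hq|x e p hp] Q a s /=.
- move=> _ h hs; exists 1%N, s, a; split=> //; exact: ExecSkip.
- move=> x0 h hs; have [E1 _ _] := simE hs.
  eexists; eexists; exists (setn a x (neval a e)); split; first exact: ExecISet.
  + by [].
  + by rewrite /= E1; apply: sim_setn.
  + move=> y; rewrite inE /= /upd => yx.
    have -> : (y.*2 == x.*2) = false by lia.
    by have -> : (y.*2.+1 == x.*2) = false by lia.
  + exact: h.
- move=> /andP[r8 we] h hs; have [E1 E2 _] := simE hs.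
  eexists; eexists; exists (setx a r (neval a i) (xeval a e)); split; first exact: ExecRSet.
  + by [].
  + case: hs => n0 hn hx; split=> // r' j r'8.
    rewrite /= /upd E1 E2 // (hn 0%N) n0.
    case: (@eqnP r' r) => [->|rr'].
      case: (eqVneq j (neval a i)) => [->|ji]; first by rewrite eqxx.
      case: eqP => [e0|_]; first by move/eqP: ji; lia.
      exact: hx.
    case: eqP => [e0|_]; first by lia.
    exact: hx.
  + by [].
  + exact: h.
- move=> /andP[wp1 wq] h hs.
  have [t1 [s1 [a1 [ex1 ht1 hs1 f1 Q1]]]] := hp _ _ _ wp1 h hs.
  have [t2 [s2 [a2 [ex2 ht2 hs2 f2 Q2]]]] := hq _ _ _ wq Q1 hs1.
  exists (t1 + t2)%N, s2, a2; split=> //; first exact: ExecSeq ex1 ex2.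
    exact: leq_add.
  move=> x; rewrite mem_cat negb_or => /andP[x1 x2].
  by have [-> ->] := f2 _ x2; exact: f1.
- move=> /and3P[wb wp1 wq].
  case: ifP => hb h hs.
    have [t1 [s1 [a1 [ex1 ht1 hs1 f1 Q1]]]] := hp _ _ _ wp1 h hs.
    have [_ _ E] := simE hs.
    eexists; exists s1, a1; split; first (by apply: (ExecIfTrue _ _ ex1); rewrite E);
      rewrite ?ltnS ?leq_add2l //; first by lia.
    by move=> x; rewrite mem_cat negb_or => /andP[x1 x2]; exact: f1.
  have [t1 [s1 [a1 [ex1 ht1 hs1 f1 Q1]]]] := hq _ _ _ wq h hs.
  have [_ _ E] := simE hs.
  eexists; exists s1, a1; split; first (by apply: (ExecIfFalse _ _ ex1); rewrite E // hb);
    rewrite ?ltnS ?leq_add2l //; first by lia.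
  by move=> x; rewrite mem_cat negb_or => /andP[x1 x2]; exact: f1.
- move=> /and3P[x0 xp wp1] [leM [Inv [I0 IS IN]]] hs; have [E1 _ _] := simE hs.
  have fx a1 k : frame (PFor x e p) a1 (setn a1 x k).
    by apply: setn_frame; exact: mem_head.
  (* [Inv] speaks of the state before the counter is set, so the machine state is compared with
     [setn a' x k] rather than with [a']. *)
  pose J k s' := (exists a', [/\ sim n (setn a' x k) s', frame (PFor x e p) a a'
      & Inv k a']) /\ (forall y, y \notin x :: nwrites p ->
       imem s' y.*2 = imem s y.*2 /\ imem s' y.*2.+1 = imem s y.*2.+1).
  have [|||t [s' [ex ht xN [[a' [sa' fa' Ia']] fs']]]] :=
    @exec_for x (cn e) (compile p) s (neval a e) (tbound M p) J.
  + exact: E1.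
  + split.
      exists a; split=> //.
      have [n0 hn hx] := sim_setn 0 x0 hs; split=> // y.
      rewrite -hn /= /upd; case: ifP => // _.
      by have -> : (y.*2 == x.*2.+1) = false by lia.
    move=> y; rewrite inE negb_or => /andP[yx yp] /=; rewrite /upd.
    have -> : (y.*2 == x.*2) = false by lia.
    have -> : (y.*2.+1 == x.*2) = false by lia.
    have -> : (y.*2 == x.*2.+1) = false by lia.
    by have -> : (y.*2.+1 == x.*2.+1) = false by lia.
  + move=> k s1 kN [[a1 [sa1 fa1 I1]] fs1] xk xN.
    have W := IS _ _ kN fa1 I1.
    have W' := wp_frame W (Q := fun a2 => frame p (setn a1 x k) a2 /\ Inv k.+1 a2)
       (fun _ f h => conj f h).
    have [t1 [s2 [a2 [ex1 ht1 hs2 f2 [F2 Q2]]]]] := hp _ _ _ wp1 W' sa1.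
    exists t1, s2; have [fx1 fx2] := f2 _ xp; split=> //.
    * by rewrite fx1.
    * by rewrite fx2.
    * split.
        exists a2; split=> //; first exact: sim_setn.
        apply: (frame_trans fa1); apply: (frame_trans (fx a1 k)).
        by apply: frame_sub F2 => z hz //=; rewrite inE hz orbT.
      move=> y /[dup] yy; rewrite inE negb_or => /andP[yx yp] /=; rewrite /upd.
      have -> : (y.*2 == x.*2) = false by lia.
      have -> : (y.*2.+1 == x.*2) = false by lia.
      by have [-> ->] := f2 _ yp; exact: fs1.
  + exists t, s', (setn a' x (neval a e)); split=> //; last exact: IN.
    apply: (leq_trans ht); rewrite leq_add2l leq_mul2r.
    by rewrite leM orbT.
Qed.

(** The [3n + 1] cells are the two halves of D, the values of f and one parameter. In array 0 they
    fall under the program logic like any other array. *)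
Definition load : cmd :=
  for_loop 1 (IAdd (IMul (IConst 3) (ICell (IConst 0))) (IConst 1))
    (RSet (address 0 (ICell (IConst 2))) (RCell (ICell (IConst 2)))).

Lemma load_sound n (l : seq R) : (size l <= 3 * n + 1)%N ->
  exists t s' a, [/\ exec load (State (fun k => if k == 0%N then n else 0%N) (nth 0 l)) t s',
    (t <= 500 * n.+1)%N, sim n a s' & xr a 0 = nth 0 l].
Proof.
move=> szl.
pose s0 := State (fun k => if k == 0%N then n else 0%N) (nth (0 : R) l).
(* The last clause says that array cells not yet reached are still 0, which agrees with the default
   of [nth] beyond the end of [l]. *)
pose J k (s : state R) := imem s 0%N = n /\
  (forall j, (j < k)%N -> rmem s (3 * n + 1 + 8 * j)%N = nth 0 l j) /\
  (forall j, (j <= 3 * n)%N -> rmem s j = nth 0 l j) /\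
  (forall j, (k <= j)%N -> rmem s (3 * n + 1 + 8 * j)%N = 0).
have [|||t [s' [ex ht xN [h0 [h1 [h2 h3]]]]]] :=
  @exec_for 1 (IAdd (IMul (IConst 3) (ICell (IConst 0))) (IConst 1))
   (RSet (address 0 (ICell (IConst 2))) (RCell (ICell (IConst 2)))) s0 (3 * n + 1)%N
   30 J.
- by [].
- split=> //; split=> //; split=> //= j _; rewrite nth_default //; lia.
- move=> k s kN [h0 [h1 [h2 h3]]] xk xN.
  eexists; eexists; split; first exact: ExecRSet.
  + by [].
  + exact: xk.
  + exact: xN.
  + change (1.*2) with 2%N in *; rewrite /J /= h0 xk /upd /= ?addn0; split=> //; split; last split.
    * move=> j; rewrite ltnS leq_eqVlt => /orP[/eqP->|jk].
        by rewrite eqxx h2 //; lia.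
      case: eqP => [?|_]; first by lia.
      exact: h1.
    * move=> j jn; case: eqP => [?|_]; first by lia.
      exact: h2.
    * move=> j kj; case: eqP => [?|_]; first by lia.
      apply: h3; lia.
pose a := AState (fun x => imem s' x.*2) (fun r i => rmem s' (3 * n + 1 + (8 * i + r))%N).
exists t, s', a; split=> //.
- by apply: (leq_trans ht) => /=; lia.
- apply: funext => j /=; rewrite addn0.
  case: (ltnP j (3 * n + 1)) => jn; first exact: h1.
  by rewrite h3 // nth_default //; lia.
Qed.

Definition run (p : prog) (r : nat) : cmd :=
  Seq load (Seq (compile p) (RSet (IConst 0) (RCell (address r (IConst 0))))).

(** The exponent is at least 1 because loading takes linear time. Only variable 0 and array 0 are
    known when [p] starts. *)
Lemma run_sound (X : finType) (D : fdist R (X * bool)%type) (f : X -> R) ps p r M Q :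
  (size ps <= 1)%N -> (r < 8)%N -> wf p -> (#|X| < M)%N ->
  (forall a, nv a 0%N = #|X| -> xr a 0 = rmem (input D f ps) -> wp M p Q a) ->
  exists t a, [/\ computes_in (run p r) (input D f ps) t (xr a r 0),
    (t <= (tbound 1 p + 600) * M ^ (maxn 1 (depth p)))%N & Q a].
Proof.
move=> szp r8 wp1 nM h.
set l := ([seq D (x, false) | x <- enum X] ++
                [seq D (x, true) | x <- enum X] ++
                [seq f x | x <- enum X] ++ ps).
have [|t1 [s1 [a1 [ex1 ht1 hs1 xa1]]]] := @load_sound #|X| l.
  have eX : size (enum X) = #|X| by rewrite cardE.
  by rewrite /l !size_cat 3!size_map !eX; lia.
have W := h a1 (let: And3 h _ _ := hs1 in h) xa1.
have [t2 [s2 [a2 [ex2 ht2 hs2 _ Q2]]]] := wp_sound wp1 W hs1.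
exists (t1 + (t2 + (icost (IConst 0) + rcost (RCell (address r (IConst 0)))).+1))%N, a2.
split=> //.
  eexists; first exact: (ExecSeq ex1 (ExecSeq ex2 (ExecRSet _ _ _))).
  rewrite /= /upd /=; case: hs2 => n0 hn hx.
  by rewrite (hn 0%N) n0 -(hx r 0%N r8).
have M0 : (0 < M)%N by lia.
have tb := tbound_poly p M0.
have b1 : (tbound 1 p * M ^ depth p <= tbound 1 p * M ^ maxn 1 (depth p))%N.
  by rewrite leq_mul2l leq_pexp2l ?leq_maxr ?orbT.
have b2 : (M <= M ^ maxn 1 (depth p))%N.
  by rewrite -{1}(expn1 M) leq_pexp2l ?leq_maxl.
have e : (icost (IConst 0) + rcost (RCell (address r (IConst 0)))).+1 = 15%N by [].
rewrite e mulnDl.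
have c1 := leq_trans ht2 (leq_trans tb b1).
clear - ht1 c1 b2 nM.
set u := (M ^ _)%N in b2 c1 *; set v := (tbound 1 p * u)%N in c1 *; clearbody u v.
lia.
Qed.

End ProgramLogic.

Arguments wp : simpl never.

(** * Loop rules; integer division, floors and minima by loops *)

Section LoopLemmas.
Variables (R : realType) (M : nat).
Implicit Types (a : astate R) (Q : astate R -> Prop).

Lemma wp_seq p q Q a : wp M p (wp M q Q) a -> wp M (PSeq p q) Q a.
Proof. by []. Qed.

Lemma wp_setn x e Q a : Q (setn a x (neval a e)) -> wp M (PSetN x e) Q a.
Proof. by []. Qed.

Lemma wp_setx r i e Q a :
  Q (setx a r (neval a i) (xeval a e)) -> wp M (PSetX r i e) Q a.
Proof. by []. Qed.

Lemma wp_if b p q Q a : (ceval a b -> wp M p Q a) ->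
  (~~ ceval a b -> wp M q Q a) -> wp M (PIf b p q) Q a.
Proof.
by case E: (ceval a b) => h1 h2; rewrite /wp E; [exact: h1 | exact: h2].
Qed.

Lemma wp_for N (Inv : nat -> astate R -> Prop) x e p Q a :
  neval a e = N -> (N <= M)%N -> Inv 0%N a ->
  (forall k a', (k < N)%N -> frame (PFor x e p) a a' -> Inv k a' ->
     wp M p (Inv k.+1) (setn a' x k)) ->
  (forall a', frame (PFor x e p) a a' -> Inv N a' -> Q (setn a' x N)) ->
  wp M (PFor x e p) Q a.
Proof. by move=> eN leN I0 IS IN; rewrite /wp eN; split=> //; exists Inv. Qed.

Lemma xr_setx a r i v j : xr (setx a r i v) r j = if j == i then v else xr a r j.
Proof. by rewrite /= eqnE eqxx. Qed.

Definition add_abs (r : nat) (i : nexp) (w u v : xexp) : prog :=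
  PIf (CLeX v u) (PSetX r i (XAdd (XR r i) (XMul w (XSub u v))))
                 (PSetX r i (XAdd (XR r i) (XMul w (XSub v u)))).

Lemma wp_add_abs r i w u v Q a :
  Q (setx a r (neval a i) (xr a r (neval a i) +
       xeval a w * `|xeval a u - xeval a v|)) -> wp M (add_abs r i w u v) Q a.
Proof.
move=> h; apply: wp_if => /= uv; apply: wp_setx => /=; move: h.
  by rewrite ger0_norm ?subr_ge0.
by rewrite distrC gtr0_norm // subr_gt0 ltNge.
Qed.

(** The quotient is counted up for as long as [(q + 1) b <= r]. With b > 0 it is at most r, so [r]
    rounds are enough. *)
Definition divide (q t r b : nat) : prog :=
  PSeq (PSetN q (NC 0))
       (PFor t (NV r) (PIf (CLeN (NMul (NAdd (NV q) (NC 1)) (NV b)) (NV r))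
          (PSetN q (NAdd (NV q) (NC 1))) PSkip)).

Lemma nv_setn a x k : nv (setn a x k) x = k.
Proof. by rewrite /= eqnE eqxx. Qed.

Lemma nv_setn_neq a x k y : y != x -> nv (setn a x k) y = nv a y.
Proof. by move=> /negbTE h; rewrite /= eqnE h. Qed.

Lemma wp_divide q t r b a : uniq [:: q; t; r; b] -> (0 < nv a b)%N ->
  (nv a r <= M)%N -> wp M (divide q t r b) (fun a' => nv a' q = nv a r %/ nv a b)%N a.
Proof.
rewrite /= !inE !negb_or => /and4P[/and3P[qt qr qb] /andP[tr tb] rb _] b0 rM.
apply: wp_seq; apply: wp_setn.
apply: (@wp_for (nv a r) (fun k a' => nv a' q = minn k (nv a r %/ nv a b))%N) => //.
- by rewrite [neval _ _]nv_setn_neq // eq_sym.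
- by rewrite nv_setn min0n.
- move=> k a' kr [Fn _] Ik.
  have er : nv (setn a' t k) r = nv a r.
    rewrite nv_setn_neq 1?eq_sym // Fn ?nv_setn_neq // 1?eq_sym //.
    by rewrite /= !inE negb_or !(eq_sym r) tr qr.
  have eb : nv (setn a' t k) b = nv a b.
    rewrite nv_setn_neq 1?eq_sym // Fn ?nv_setn_neq // 1?eq_sym //.
    by rewrite /= !inE negb_or !(eq_sym b) tb qb.
  have eq : nv (setn a' t k) q = minn k (nv a r %/ nv a b) by rewrite nv_setn_neq.
  apply: wp_if; rewrite [ceval _ _]/= -[X in (X + _)%N]/(nv (setn a' t k) q)
     -[X in (_ <= X)%N]/(nv (setn a' t k) r) -[X in (_ * X)%N]/(nv (setn a' t k) b)
     er eb eq -leq_divRL // => h.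
    by apply: wp_setn; rewrite nv_setn /= -[X in (X + _)%N]/(nv (setn a' t k) q) eq; lia.
  by change (nv (setn a' t k) q = minn k.+1 (nv a r %/ nv a b)); rewrite eq; lia.
- move=> a' _ h; rewrite nv_setn_neq // h; apply/minn_idPr; exact: leq_div.
Qed.

(** Comparison is the only passage from reals to naturals, so the floor is counted up; [m] rounds
    suffice when the value is at most [m]. *)
Definition floor_of (c t m : nat) (e : xexp) : prog :=
  PSeq (PSetN c (NC 0))
       (PFor t (NV m) (PIf (CLeX (XN (NAdd (NV c) (NC 1))) e)
          (PSetN c (NAdd (NV c) (NC 1))) PSkip)).

Lemma wp_floor c t m e a (v : R) : uniq [:: c; t; m] ->
  (forall a', frame (floor_of c t m e) a a' -> xeval a' e = v) ->
  0 <= v <= (nv a m)%:R -> (nv a m <= M)%N ->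
  wp M (floor_of c t m e) (fun a' => (nv a' c)%:R <= v < (nv a' c).+1%:R) a.
Proof.
rewrite /= !inE !negb_or => /and3P[/andP[ct cm] tm _] ev /andP[v0 vm] mM.
apply: wp_seq; apply: wp_setn.
apply: (@wp_for (nv a m) (fun k a' => [/\ (nv a' c)%:R <= v, (nv a' c <= k)%N
   & nv a' c = k \/ v < (nv a' c).+1%:R])) => //.
- by rewrite [neval _ _]nv_setn_neq // eq_sym.
- by rewrite nv_setn; split=> //; left.
- move=> k a' km Fr [I1 I2 I3].
  have ee : xeval (setn a' t k) e = v.
    apply: ev; apply: (@frame_trans _ _ _ (setn a c 0)).
      by apply: setn_frame; rewrite !inE eqxx.
    apply: (@frame_trans _ _ _ a'); first by apply: frame_sub Fr => z //=; rewrite !inE => ->; rewrite orbT.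
    by apply: setn_frame; rewrite !inE eqxx orbT.
  have ec : nv (setn a' t k) c = nv a' c by rewrite nv_setn_neq.
  apply: wp_if; rewrite [ceval _ _]/= ee -[X in (X + _)%N]/(nv (setn a' t k) c) ec addn1.
    move=> h; apply: wp_setn; rewrite nv_setn [neval _ _]/=.
    rewrite -[X in (X + _)%N]/(nv (setn a' t k) c) ec addn1; split=> //.
    by case: I3 => [->|]; [left | rewrite ltNge h].
  rewrite -ltNge => h.
  change ([/\ (nv (setn a' t k) c)%:R <= v, (nv (setn a' t k) c <= k.+1)%N
   & nv (setn a' t k) c = k.+1 \/ v < (nv (setn a' t k) c).+1%:R]); rewrite ec.
  split=> //; first exact: leqW.
  by right.
- move=> a' _ [I1 I2 I3]; rewrite nv_setn_neq // I1 /=.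
  case: I3 => [->|//]; apply: le_lt_trans vm _; by rewrite ltr_nat.
Qed.

Definition is_min (m : nat) (F : nat -> R) (v : R) : Prop :=
  (exists2 j, (j < m)%N & v = F j) /\ forall j, (j < m)%N -> v <= F j.

(** In round [x = 0] the cell holds an unknown old value and is overwritten unconditionally, which
    replaces an initial infinity. *)
Definition update_min (r x : nat) (cand : nat) : prog :=
  PIf (CAnd (CNot (CLeN (NV x) (NC 0))) (CLeX (XR r (NC 0)) (XR cand (NC 0))))
    PSkip (PSetX r (NC 0) (XR cand (NC 0))).

Lemma wp_update_min r x cand k (F : nat -> R) a : nv a x = k ->
  ((0 < k)%N -> is_min k F (xr a r 0)) -> xr a cand 0 = F k ->
  wp M (update_min r x cand) (fun a' => is_min k.+1 F (xr a' r 0)) a.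
Proof.
move=> xk Ik ck; apply: wp_if; rewrite [ceval _ _]/= xk ck -ltnNge.
  move=> /andP[k0 le]; have [[j jk e] h] := Ik k0; split.
    by exists j => //; exact: leqW.
  by move=> i; rewrite ltnS leq_eqVlt => /orP[/eqP ->|/h].
rewrite negb_and -eqn0Ngt -ltNge => h; apply: wp_setx; rewrite xr_setx eqxx /= ck.
split; first by exists k.
move=> i; rewrite ltnS leq_eqVlt => /orP[/eqP ->//|ik].
have k0 : (0 < k)%N by lia.
case/orP: h => [/eqP k00|/ltW]; first by rewrite k00 in k0.
by move=> h; apply: (le_trans h); have [_] := Ik k0; apply.
Qed.

End LoopLemmas.

(** * Calibration distance in terms of the input cells *)

Section Indexed.
Variable R : realType.

(** Calibration with the conditional probability multiplied out. The equation is trivial on null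
    levels and for [alpha] outside [0,1], so it carries no guard. *)
Definition cal (n : nat) (d0 d1 h : nat -> R) : Prop :=
  (forall i, (i < n)%N -> 0 <= h i <= 1) /\
  forall alpha, \sum_(i < n | h i == alpha) (d1 i - alpha * (d0 i + d1 i)) = 0.

Definition cost (n : nat) (d0 d1 f h : nat -> R) : R :=
  \sum_(i < n) (d0 i + d1 i) * `|f i - h i|.

Variables (X : finType) (D : fdist R (X * bool)%type).

Lemma sum_enum (x0 : X) (P : pred X) (F : X -> R) :
  \sum_(x | P x) F x =
  \sum_(i < #|X| | P (nth x0 (enum X) i)) F (nth x0 (enum X) i).
Proof.
transitivity (\sum_(x <- enum X | P x) F x); first by rewrite big_enum_cond.
have sz : size (enum X) = #|X| by rewrite cardE.
by rewrite (big_nth x0) big_mkord sz.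
Qed.

Lemma Pr_fst (P : pred X) :
  Pr D [pred z | P z.1] = \sum_(x | P x) (D (x, false) + D (x, true)).
Proof.
rewrite /Pr; transitivity (\sum_(x | P x) \sum_(b | true) D (x, b)).
  rewrite pair_big /=; apply: eq_big => [z|[x b] _ //] /=; by rewrite andbT.
by apply: eq_bigr => x _; rewrite big_bool addrC.
Qed.

Lemma Pr_true (P : pred X) :
  Pr D (predI [pred z | z.2] [pred z | P z.1]) = \sum_(x | P x) D (x, true).
Proof.
rewrite /Pr; transitivity (\sum_(x | P x) \sum_(b | b) D (x, b)).
  rewrite pair_big /=; apply: eq_big => [z|[x b] _ //] /=; by rewrite andbC.
by apply: eq_bigr => x _; rewrite big_mkcond big_bool /= addr0.
Qed.

Lemma marginalE x : marginal D x = D (x, false) + D (x, true).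
Proof. by rewrite /marginal (Pr_fst (pred1 x)) big_pred1_eq. Qed.

Lemma calibratedE g : calibrated D g <-> predictor g /\
  forall alpha, \sum_(x | g x == alpha)
     (D (x, true) - alpha * (D (x, false) + D (x, true))) = 0.
Proof.
have E alpha : \sum_(x | g x == alpha)
     (D (x, true) - alpha * (D (x, false) + D (x, true))) =
   Pr D (predI [pred z | z.2] [pred z | g z.1 == alpha])
     - alpha * Pr D [pred z | g z.1 == alpha].
  rewrite (Pr_true (fun x => g x == alpha)) (Pr_fst (fun x => g x == alpha)).
  by rewrite big_split /= sumrN mulr_sumr.
split=> -[pg hg]; split=> // alpha.
- rewrite E; case: (boolP [exists x, g x == alpha]) => [/existsP[x /eqP gx]|].
    have P0 : 0 <= Pr D [pred z | g z.1 == alpha].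
      by apply: sumr_ge0 => z _; exact: pmf_ge0.
    move: P0; rewrite le_eqVlt => /orP[/eqP P0|P0]; last first.
      rewrite -{2}(hg alpha) //; last by rewrite -gx.
      by rewrite /cPr divfK ?subrr // gt_eqF.
    (* A null level: nonnegative masses with sum 0 all vanish, those with label 1 included. *)
    suff -> : Pr D (predI [pred z | z.2] [pred z | g z.1 == alpha]) = 0.
      by rewrite -P0 mulr0 subrr.
    move: P0; rewrite (Pr_fst (fun x => g x == alpha)) => /esym/eqP.
    rewrite psumr_eq0; last by move=> y _; rewrite addr_ge0 ?pmf_ge0.
    move=> /allP h0; rewrite (Pr_true (fun x => g x == alpha)).
    apply: big1 => y gy; have := h0 y (mem_index_enum _); rewrite gy /=.
    by rewrite paddr_eq0 ?pmf_ge0 // => /andP[_ /eqP].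
  rewrite negb_exists => /forallP h.
  rewrite (Pr_true (fun x => g x == alpha)) (Pr_fst (fun x => g x == alpha)).
  by rewrite !big1 ?mulr0 ?subrr // => x gx; move: (h x); rewrite gx.
- move=> _ P0; have := hg alpha; rewrite E => /eqP; rewrite subr_eq0 => /eqP e.
  by rewrite /cPr e mulfK // gt_eqF.
Qed.

Variable f : X -> R.
Local Notation n := #|X|.
Variable ps : seq R.
Local Notation inp := (rmem (input D f ps)).
Local Notation d0 := inp.
Local Notation d1 := (fun i => inp (n + i)%N).
Local Notation ff := (fun i => inp (2 * n + i)%N).

Lemma inpE (x0 : X) i : (i < n)%N -> let x := nth x0 (enum X) i in
  [/\ inp i = D (x, false), inp (n + i)%N = D (x, true) & inp (2 * n + i)%N = f x].
Proof.
move=> i_n /=; have sz : size (enum X) = n by rewrite cardE.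
rewrite !nth_cat 3!size_map sz i_n; split.
- by rewrite (nth_map x0) ?sz.
- have -> : (n + i < n)%N = false by lia.
  by rewrite addKn i_n (nth_map x0) ?sz.
- have -> : (2 * n + i < n)%N = false by lia.
  have -> : (2 * n + i - n < n)%N = false by lia.
  have -> : (2 * n + i - n - n = i)%N by lia.
  by rewrite i_n (nth_map x0) ?sz.
Qed.

Lemma inp_params i : inp (3 * n + i)%N = nth 0 ps i.
Proof.
have sz : size (enum X) = n by rewrite cardE.
rewrite /= !nth_cat 3!size_map sz.
have -> : (3 * n + i < n)%N = false by lia.
have -> : (3 * n + i - n < n)%N = false by lia.
have -> : (3 * n + i - n - n < n)%N = false by lia.
by have -> : (3 * n + i - n - n - n = i)%N by lia.
Qed.

Lemma X_inhabited : inhabited X.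
Proof.
apply: contrapT => noX; have := pmf_sum1 D; rewrite big1 => [/eqP|[x b] _].
  by rewrite eq_sym oner_eq0.
by case: noX; exact: (inhabits x).
Qed.

Lemma card_X_gt0 : (0 < n)%N.
Proof. by have [x] := X_inhabited; apply/card_gt0P; exists x. Qed.

Lemma inp_ge0 i : (i < n)%N -> 0 <= d0 i /\ 0 <= d1 i.
Proof.
have [x0] := X_inhabited; move=> /(inpE x0)[-> -> _].
by split; exact: pmf_ge0.
Qed.

Lemma inp_sum1 : \sum_(i < n) (d0 i + d1 i) = 1.
Proof.
have [x0] := X_inhabited.
have := pmf_sum1 D; rewrite (_ : \sum_t D t = Pr D [pred z | xpredT z.1]) //.
rewrite (Pr_fst xpredT) (sum_enum x0) => <-; apply: eq_bigr => i _.
by have [-> -> _] := inpE x0 (ltn_ord i).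
Qed.

Lemma inp_f01 : predictor f -> forall i, (i < n)%N -> 0 <= ff i <= 1.
Proof.
by have [x0] := X_inhabited; move=> pf i /(inpE x0)[_ _ ->].
Qed.

Lemma cal_of_calibrated g : calibrated D g ->
  exists2 h, cal n d0 d1 h & cost n d0 d1 ff h = dist D f g.
Proof.
have [x0] := X_inhabited; move=> /calibratedE[pg hg].
exists (fun i => g (nth x0 (enum X) i)).
  split=> [i _|alpha]; first exact: pg.
  rewrite -[RHS](hg alpha) (sum_enum x0); apply: eq_bigr => i _.
  by have [-> -> _] := inpE x0 (ltn_ord i).
rewrite /cost /dist (sum_enum x0); apply: eq_bigr => i _.
by have [-> -> ->] := inpE x0 (ltn_ord i); rewrite marginalE.
Qed.

Lemma calibrated_of_cal h : cal n d0 d1 h ->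
  exists2 g, calibrated D g & dist D f g = cost n d0 d1 ff h.
Proof.
have [x0] := X_inhabited; move=> [ph hh].
pose g (x : X) := h (enum_rank x).
have gE (i : 'I_n) : g (nth x0 (enum X) i) = h i.
  rewrite /g (_ : nth x0 (enum X) i = enum_val i) ?enum_valK //.
  by rewrite (enum_val_nth x0).
exists g.
  apply/calibratedE; split=> [x|alpha]; first exact: ph.
  rewrite -[RHS](hh alpha) (sum_enum x0); apply: eq_big => [i|i _].
    by rewrite gE.
  by have [-> -> _] := inpE x0 (ltn_ord i).
rewrite /cost /dist (sum_enum x0); apply: eq_bigr => i _.
by rewrite gE; have [-> -> ->] := inpE x0 (ltn_ord i); rewrite marginalE.
Qed.

(** The predictor of the second hypothesis also makes the set of distances nonempty, without which
    [inf] would be a default value. With e = 0 this yields equality. *)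
Lemma CalDist_approx v e :
  (forall h, cal n d0 d1 h -> v <= cost n d0 d1 ff h + e) ->
  (exists2 h, cal n d0 d1 h & cost n d0 d1 ff h <= v + e) ->
  `|v - CalDist D f| <= e.
Proof.
move=> lo [h ch hv].
have lb g : calibrated D g -> v - e <= dist D f g.
  by move=> /cal_of_calibrated[h' ch' <-]; rewrite lerBlDr lo.
have [g cg dg] := calibrated_of_cal ch.
have gS : [set dist D f g | g in [set g | calibrated D g]]%classic (dist D f g).
  by exists g.
rewrite ler_distlC; apply/andP; split.
  apply: lb_le_inf; first by exists (dist D f g).
  by move=> _ [g' cg' <-]; exact: lb.
apply: le_trans hv; rewrite -dg; apply: ge_inf => //.
by exists (v - e) => _ [g' cg' <-]; exact: lb.
Qed.

End Indexed.

(** * Class means and rounding *)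

Lemma big_classes (T : Type) (idx : T) (op : Monoid.com_law idx) n m
    (a : nat -> nat) (P : pred nat) (F : nat -> T) :
  (forall i, (i < n)%N -> (a i < m)%N) ->
  \big[op/idx]_(i < n | P i) F i =
  \big[op/idx]_(j < m) \big[op/idx]_(i < n | P i && (a i == j)) F i.
Proof.
move=> am; case: m am => [|m] am.
  by rewrite big_ord0 big1 // => i _; have := am i (ltn_ord i).
rewrite (partition_big (fun i : 'I_n => inord (a i) : 'I_m.+1) xpredT) //=.
apply: eq_bigr => j _; apply: eq_bigl => i; congr (_ && _).
by rewrite -val_eqE /= inordK // am.
Qed.

Section ClassMeans.
Variables (R : realType) (n : nat) (d0 d1 f : nat -> R).
Hypothesis d_ge0 : forall i, (i < n)%N -> 0 <= d0 i /\ 0 <= d1 i.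

Local Notation D i := (d0 i + d1 i).

Lemma mass_ge0 i : (i < n)%N -> 0 <= D i.
Proof. by move=> /d_ge0[h0 h1]; exact: addr_ge0. Qed.

Definition class_mean (a : nat -> nat) (j : nat) : R :=
  (\sum_(i < n | a i == j) d1 i) / (\sum_(i < n | a i == j) D i).

Lemma sum_classes m (a : nat -> nat) (P : pred nat) (F : nat -> R) :
  (forall i, (i < n)%N -> (a i < m)%N) ->
  \sum_(i < n | P i) F i = \sum_(j < m) \sum_(i < n | P i && (a i == j)) F i.
Proof. exact: big_classes. Qed.

(** Valid for null classes too: the quotient is then 0 by convention, and the mass of label 1 is 0
    as well. *)
Lemma class_meanE a j : class_mean a j * (\sum_(i < n | a i == j) D i) =
  \sum_(i < n | a i == j) d1 i.
Proof.
rewrite /class_mean; case: (eqVneq (\sum_(i < n | a i == j) D i) 0) => [e|]; last first.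
  by move=> ?; rewrite divfK.
rewrite e mulr0; move/eqP: e; rewrite psumr_eq0; last by move=> i _; exact: mass_ge0.
move=> /allP h; rewrite big1 // => i ai.
have := h i (mem_index_enum _); rewrite ai /=; have [h0 h1] := d_ge0 (ltn_ord i).
by rewrite paddr_eq0 // => /andP[_ /eqP].
Qed.

Lemma class_mean01 a j : 0 <= class_mean a j <= 1.
Proof.
have h0 : 0 <= \sum_(i < n | a i == j) d1 i.
  by apply: sumr_ge0 => i _; have [] := d_ge0 (ltn_ord i).
have h1 : \sum_(i < n | a i == j) d1 i <= \sum_(i < n | a i == j) D i.
  by apply: ler_sum => i _; have [? _] := d_ge0 (ltn_ord i); rewrite lerDr.
have h2 := le_trans h0 h1.
rewrite /class_mean divr_ge0 //=; move: h2; rewrite le_eqVlt => /orP[/eqP <-|h2].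
  by rewrite invr0 mulr0.
by rewrite ler_pdivrMr // mul1r.
Qed.

(** Classes may share a mean, so a level set is a union of classes; each of them contributes 0 to
    the balance. *)
Lemma cal_class_mean m a : (forall i, (i < n)%N -> (a i < m)%N) ->
  cal n d0 d1 (fun i => class_mean a (a i)).
Proof.
move=> am; split=> [i _|alpha]; first exact: class_mean01.
rewrite (@sum_classes m a (fun i => class_mean a (a i) == alpha)
   (fun i => d1 i - alpha * D i)) //.
apply: big1 => j _; case: (eqVneq (class_mean a j) alpha) => [e|ne].
  transitivity (\sum_(i < n | a i == j) (d1 i - alpha * D i)).
    apply: eq_bigl => i; case: (eqVneq (a i) j) => [->|]; last by rewrite andbF.
    by rewrite e eqxx.
  by rewrite sumrB -mulr_sumr -e class_meanE subrr.
apply: big_pred0 => i; case: (eqVneq (a i) j) => [->|]; last by rewrite andbF.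
by rewrite (negbTE ne).
Qed.

(* Labels the level sets of [h] by their first elements. *)
Definition level (h : nat -> R) (i : nat) : nat :=
  find (fun k => h k == h i) (iota 0 n).

Lemma level_has (h : nat -> R) i : (i < n)%N -> has (fun k => h k == h i) (iota 0 n).
Proof. by move=> i_n; apply/hasP; exists i; rewrite ?mem_iota. Qed.

Lemma level_lt (h : nat -> R) i : (i < n)%N -> (level h i < n)%N.
Proof. by move=> /(level_has h); rewrite has_find size_iota. Qed.

Lemma h_level (h : nat -> R) i : (i < n)%N -> h (level h i) = h i.
Proof.
move=> i_n; have := nth_find 0%N (level_has h i_n).
by rewrite nth_iota ?level_lt // => /eqP.
Qed.

Lemma level_eq (h : nat -> R) i k : (i < n)%N -> (k < n)%N ->
  (level h k == level h i) = (h k == h i).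
Proof.
move=> i_n k_n; apply/eqP/eqP => [e|e]; first by rewrite -(h_level h k_n) e h_level.
by apply: eq_find => l; rewrite e.
Qed.

(** On a level of positive mass, calibration makes the class mean equal to [h]; on a null level
    every point has mass 0 and costs nothing. *)
Lemma cost_level h : cal n d0 d1 h ->
  cost n d0 d1 f (fun i => class_mean (level h) (level h i)) = cost n d0 d1 f h.
Proof.
move=> [_ hc]; apply: eq_bigr => i _.
have e1 : \sum_(k < n | level h k == level h i) d1 k =
   h i * \sum_(k < n | level h k == level h i) D k.
  apply/eqP; rewrite -subr_eq0 mulr_sumr -sumrB; apply/eqP.
  by rewrite -[RHS](hc (h i)); apply: eq_bigl => k; rewrite level_eq.
case: (eqVneq (\sum_(k < n | level h k == level h i) D k) 0) => [e|ne].
  move/eqP: e; rewrite psumr_eq0; last by move=> k _; exact: mass_ge0.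
  move=> /allP/(_ i (mem_index_enum _)); rewrite eqxx /= => /eqP ->.
  by rewrite !mul0r.
by rewrite /class_mean e1 mulfK.
Qed.

(** [P] is a union of level sets of [h], each contributing 0. It is applied to the points whose
    values round to the same multiple of [1/K]. *)
Lemma cal_sum_level h (P : pred nat) : cal n d0 d1 h ->
  (forall i k, (i < n)%N -> (k < n)%N -> h i = h k -> P i = P k) ->
  \sum_(i < n | P i) (d1 i - h i * D i) = 0.
Proof.
move=> [_ hc] hP; rewrite (@sum_classes n (level h) P (fun i => d1 i - h i * D i)); last first.
  exact: level_lt.
apply: big1 => j _.
case: (boolP [exists i : 'I_n, P i && (level h i == j)]) => [/existsP[k /andP[Pk /eqP <-]]|].
  rewrite -[RHS](hc (h k)); apply: eq_big => [i|i /andP[_]].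
    rewrite level_eq //; case: eqP => [e|_]; last by rewrite andbF.
    by rewrite (hP i k) ?Pk.
  by rewrite level_eq // => /eqP ->.
by move=> /existsPn h0; apply: big_pred0 => i; apply/negbTE.
Qed.

Hypothesis D_sum1 : \sum_(i < n) D i = 1.

(** * The rounded objective and its distance from the true cost *)

Section Rounding.
Variables (K M : nat) (c0 c1 : nat -> nat).
Hypotheses (K_gt0 : (0 < K)%N) (M_gt0 : (0 < M)%N).
Hypothesis c0P : forall i, (i < n)%N -> (c0 i)%:R <= M%:R * d0 i < (c0 i).+1%:R.
Hypothesis c1P : forall i, (i < n)%N -> (c1 i)%:R <= M%:R * d1 i < (c1 i).+1%:R.

(** For [u] zeros and [v] ones in units of [1/M] this is | v/M - (j/K)(u + v)/M |, the calibration
    error of level [j/K], over a common denominator. *)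
Definition imbalance (j u v : nat) : R :=
  `|(K%:R - j%:R) * v%:R - j%:R * u%:R| / (K%:R * M%:R).

Definition objective (a : nat -> nat) : R :=
  \sum_(i < n) D i * `|f i - (a i)%:R / K%:R| +
  \sum_(j < K.+1) imbalance j (\sum_(i < n | a i == j) c0 i)
                              (\sum_(i < n | a i == j) c1 i).

Let E (a : nat -> nat) (j : nat) : R :=
  \sum_(i < n | a i == j) (d1 i - j%:R / K%:R * D i).

Let K_gt0' : 0 < K%:R :> R. Proof. by rewrite ltr0n. Qed.
Let M_gt0' : 0 < M%:R :> R. Proof. by rewrite ltr0n. Qed.

(** A point contributes (1 - al) d1 - al d0 to the error. The two floors change it in opposite
    directions, by at most (1 - al)/M and al/M, so one [1/M] per point is enough. *)
Lemma imbalance_approx (a : nat -> nat) (j : nat) : (j <= K)%N ->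
  `|imbalance j (\sum_(i < n | a i == j) c0 i) (\sum_(i < n | a i == j) c1 i)
    - `|E a j| | <= \sum_(i < n | a i == j) M%:R^-1.
Proof.
move=> jK; set al := j%:R / K%:R : R.
have al0 : 0 <= al by rewrite divr_ge0 ?ler0n.
have al1 : al <= 1 by rewrite ler_pdivrMr // mul1r ler_nat.
have eq1 : imbalance j (\sum_(i < n | a i == j) c0 i) (\sum_(i < n | a i == j) c1 i) =
   `|\sum_(i < n | a i == j) ((1 - al) * ((c1 i)%:R / M%:R) - al * ((c0 i)%:R / M%:R))|.
  rewrite /imbalance -[in LHS](@ger0_norm _ (K%:R * M%:R)) ?mulr_ge0 ?ler0n //.
  rewrite -normf_div; congr `| _ |.
  rewrite sumrB -!mulr_sumr -!mulr_suml -!natr_sum /al.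
  by field; rewrite !gt_eqF.
rewrite eq1; apply: le_trans (ler_dist_dist _ _) _.
rewrite -sumrB; apply: le_trans (ler_norm_sum _ _ _) _; apply: ler_sum => i _.
have [a0 a1] := andP (c0P (ltn_ord i)); have [b0 b1] := andP (c1P (ltn_ord i)).
set u := (c1 i)%:R / M%:R : R; set v := (c0 i)%:R / M%:R : R; set m := M%:R^-1 : R.
have u1 : u <= d1 i by rewrite ler_pdivrMr // mulrC.
have v1 : v <= d0 i by rewrite ler_pdivrMr // mulrC.
have u2 : d1 i <= u + m.
  by rewrite /u /m -{2}[M%:R^-1]mul1r -mulrDl ler_pdivlMr // mulrC natr1 ltW.
have v2 : d0 i <= v + m.
  by rewrite /v /m -{2}[M%:R^-1]mul1r -mulrDl ler_pdivlMr // mulrC natr1 ltW.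
have h1 : 0 <= al * (d0 i - v) by rewrite mulr_ge0 // subr_ge0.
have h2 : al * (d0 i - v) <= al * m by rewrite ler_wpM2l // lerBlDl.
have h3 : 0 <= (1 - al) * (d1 i - u) by rewrite mulr_ge0 // subr_ge0.
have h4 : (1 - al) * (d1 i - u) <= (1 - al) * m.
  by rewrite ler_wpM2l // ?lerBlDl // subr_ge0.
have m0 : 0 <= m by rewrite invr_ge0 ler0n.
have h5 : 0 <= al * m by rewrite mulr_ge0.
have h6 : al * m <= m by rewrite ler_piMl.
rewrite -/al ler_norml; apply/andP; split; lra.
Qed.

Lemma objective_approx a : (forall i, (i < n)%N -> (a i < K.+1)%N) ->
  `|objective a - (\sum_(i < n) D i * `|f i - (a i)%:R / K%:R| +
     \sum_(j < K.+1) `|E a j|)| <= n%:R / M%:R.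
Proof.
move=> aK; rewrite /objective opprD addrACA subrr add0r -sumrB.
apply: le_trans (ler_norm_sum _ _ _) _.
apply: le_trans (_ : _ <= \sum_(j < K.+1) \sum_(i < n | a i == j) M%:R^-1) _.
  by apply: ler_sum => j _; apply: imbalance_approx; rewrite -ltnS.
rewrite -(@sum_classes K.+1 a xpredT (fun=> M%:R^-1)) //.
by rewrite sumr_const card_ord mulr_natl.
Qed.

(** By the triangle inequality through [j/K]: summed over level [j], the distance from [j/K] to the
    class mean is the mass of the level times that gap, which is [|E a j|]. *)
Lemma cost_le_objective a : (forall i, (i < n)%N -> (a i < K.+1)%N) ->
  cost n d0 d1 f (fun i => class_mean a (a i)) <= objective a + n%:R / M%:R.
Proof.
move=> aK; have := objective_approx aK; rewrite ler_distlC => /andP[_ h].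
apply: le_trans (h : _ <= _).
apply: le_trans (_ : _ <= \sum_(i < n) (D i * `|f i - (a i)%:R / K%:R| +
   D i * `|(a i)%:R / K%:R - class_mean a (a i)|)) _.
  apply: ler_sum => i _; rewrite -mulrDr ler_wpM2l ?mass_ge0 //.
  exact: ler_distD.
rewrite big_split /= lerD2l.
rewrite (@sum_classes K.+1 a xpredT
   (fun i => D i * `|(a i)%:R / K%:R - class_mean a (a i)|)) //=.
apply: ler_sum => j _.
rewrite (eq_bigr (fun i : 'I_n => D i * `|(j : nat)%:R / K%:R - class_mean a j|)); last first.
  by move=> i /eqP ->.
rewrite -mulr_suml -[X in X * _]ger0_norm; last first.
  by apply: sumr_ge0 => i _; exact: mass_ge0.
rewrite -normrM mulrBr [X in _ - X]mulrC class_meanE distrC /E sumrB -mulr_sumr.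
by rewrite [X in _ - X]mulrC.
Qed.

(** The assignment rounds [h] down to multiples of [1/K]. One [1/K] pays for the change of distance,
    the other for the calibration errors of all levels together. *)
Lemma objective_le_cost h : cal n d0 d1 h ->
  exists2 a, (forall i, (i < n)%N -> (a i < K.+1)%N) &
    objective a <= cost n d0 d1 f h + (2 / K%:R + n%:R / M%:R).
Proof.
move=> /[dup] ch [h01 _]; exists (fun i => Num.truncn (K%:R * h i)).
  move=> i /h01/andP[h0 h1]; rewrite ltnS -(ler_nat R).
  apply: le_trans (_ : K%:R * h i <= _).
    by rewrite Num.Theory.truncn_le mulr_ge0 // ler0n.
  by rewrite ger_pMr.
set a := fun i : nat => _.
have aK i : (i < n)%N -> (a i < K.+1)%N.
  move=> /h01/andP[h0 h1]; rewrite ltnS -(ler_nat R).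
  apply: le_trans (_ : K%:R * h i <= _).
    by rewrite Num.Theory.truncn_le mulr_ge0 // ler0n.
  by rewrite ger_pMr.
have ha i : (i < n)%N -> `|h i - (a i)%:R / K%:R| <= K%:R^-1.
  move=> /h01/andP[h0 h1]; have t0 : 0 <= K%:R * h i by rewrite mulr_ge0 // ler0n.
  have /andP[e1 e2] := Num.Theory.truncn_itv t0.
  have e3 : (a i)%:R / K%:R <= h i by rewrite ler_pdivrMr // mulrC.
  rewrite ger0_norm ?subr_ge0 // lerBlDl -[X in _ + X]mul1r -mulrDl natr1.
  by rewrite ler_pdivlMr // mulrC ltW.
have := objective_approx aK; rewrite ler_distl => /andP[_ h1].
apply: (le_trans h1); rewrite !addrA lerD2r.
have s1 : \sum_(i < n) D i * `|f i - (a i)%:R / K%:R| <=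
    cost n d0 d1 f h + K%:R^-1.
  apply: le_trans (_ : _ <= \sum_(i < n) (D i * `|f i - h i| + D i * K%:R^-1)) _.
    apply: ler_sum => i _; rewrite -mulrDr ler_wpM2l ?mass_ge0 //.
    apply: le_trans (ler_distD (h i) _ _) _; rewrite lerD2l; exact: ha.
  by rewrite big_split /= -mulr_suml D_sum1 mul1r.
have s2 : \sum_(j < K.+1) `|E a j| <= K%:R^-1.
  apply: le_trans (_ : _ <= \sum_(j < K.+1) \sum_(i < n | a i == j) D i / K%:R) _; last first.
    rewrite -(@sum_classes K.+1 a xpredT (fun i => D i / K%:R)) //.
    by rewrite -mulr_suml D_sum1 mul1r.
  apply: ler_sum => j _.
  (* Points with equal [h] get equal [a], so calibration of [h] lets [h i * D i] replace [d1 i] in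
     the sum over the class. *)
  have -> : E a j = \sum_(i < n | a i == j) (h i - (a i)%:R / K%:R) * D i.
    have e0 : \sum_(i < n | a i == j) (d1 i - h i * D i) = 0.
      apply: (@cal_sum_level h (fun i => a i == j)) => // i k _ _ e.
      by rewrite /a e.
    rewrite -[LHS]subr0 -[X in _ - X]e0 /E -sumrB; apply: eq_bigr => i /eqP ->; ring.
  apply: le_trans (ler_norm_sum _ _ _) _; apply: ler_sum => i _.
  rewrite normrM mulrC [X in X * _]ger0_norm ?mass_ge0 // ler_wpM2l ?mass_ge0 //.
  exact: ha.
have -> : 2 / K%:R = K%:R^-1 + K%:R^-1 :> R by field; rewrite gt_eqF.
by rewrite addrA lerD.
Qed.

End Rounding.
End ClassMeans.

(** * Exhaustive search *)

Notation "p ;; q" := (PSeq p q) (at level 90, right associativity).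

Definition mass_at (i : nexp) : xexp := XAdd (XR 0 i) (XR 0 (NAdd (NV 0) i)).
Definition ones_at (i : nexp) : xexp := XR 0 (NAdd (NV 0) i).
Definition f_at (i : nexp) : xexp := XR 0 (NAdd (NMul (NC 2) (NV 0)) i).
Definition eps_at : xexp := XR 0 (NMul (NC 3) (NV 0)).
Definition xvar (r : nat) : xexp := XR r (NC 0).

Definition power (x t g : nat) (e : nexp) : prog :=
  PSetN x (NC 1) ;; PFor t e (PSetN x (NMul (NV x) (NV g))).

(* Variables: 1 is n^n, 3 the code of the assignment in base n.  Arrays: 1 the
   assignment, 2 its cost, 5 the best cost so far. *)
Definition brute : prog :=
  power 1 2 0 (NV 0) ;;
  PFor 3 (NV 1) (
    PSetN 4 (NV 3) ;;
    PFor 2 (NV 0) (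
      divide 5 6 4 0 ;;
      PSetX 1 (NV 2) (XN (NSub (NV 4) (NMul (NV 5) (NV 0)))) ;;
      PSetN 4 (NV 5)) ;;
    PSetX 2 (NC 0) (XN (NC 0)) ;;
    PFor 2 (NV 0) (
      PSetX 3 (NC 0) (XN (NC 0)) ;;
      PSetX 4 (NC 0) (XN (NC 0)) ;;
      PFor 7 (NV 0) (
        PIf (CAnd (CLeX (XR 1 (NV 7)) (XR 1 (NV 2)))
                  (CLeX (XR 1 (NV 2)) (XR 1 (NV 7))))
          (PSetX 3 (NC 0) (XAdd (xvar 3) (mass_at (NV 7))) ;;
           PSetX 4 (NC 0) (XAdd (xvar 4) (ones_at (NV 7))))
          PSkip) ;;
      add_abs 2 (NC 0) (mass_at (NV 2)) (f_at (NV 2)) (XDiv (xvar 4) (xvar 3))) ;;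
    update_min 5 3 2).

Definition digit (g s j : nat) : nat := (s %/ g ^ j) %% g.

Lemma digitE g s j : (s %/ g ^ j - s %/ g ^ j.+1 * g)%N = digit g s j.
Proof. by rewrite /digit expnSr divnMA {1}(divn_eq (s %/ g ^ j) g) addKn. Qed.

Lemma sum_recr_cond (R : realType) k (F : nat -> R) (P : pred nat) :
  \sum_(i < k.+1 | P i) F i = \sum_(i < k | P i) F i + (if P k then F k else 0).
Proof. by rewrite big_mkcond big_ord_recr /= -big_mkcond. Qed.

Section Brute.
Variables (R : realType) (M n : nat) (inp : nat -> R).
Local Notation d0 := inp.
Local Notation d1 := (fun i => inp (n + i)%N).
Local Notation ff := (fun i => inp (2 * n + i)%N).

Lemma wp_power x t g e (a : astate R) N : uniq [:: x; t; g] ->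
  (forall k, neval (setn a x k) e = N) -> (N <= M)%N ->
  wp M (power x t g e) (fun a' => nv a' x = nv a g ^ N)%N a.
Proof.
rewrite /= !inE !negb_or => /and3P[/andP[xt xg] tg _] eN NM.
apply: wp_seq; apply: wp_setn.
apply: (@wp_for _ _ N (fun k a' => nv a' x = nv a g ^ k)%N) => //.
- by rewrite nv_setn expn0.
- move=> k a' kN [Fn _] Ik; apply: wp_setn; rewrite nv_setn.
  change (nv (setn a' t k) x * nv (setn a' t k) g = nv a g ^ k.+1)%N.
  have gx : g != x by rewrite eq_sym.
  have gt : g != t by rewrite eq_sym.
  rewrite !nv_setn_neq // Ik expnS mulnC Fn ?nv_setn_neq //.
  by rewrite /= !inE negb_or gx gt.
- by move=> a' _ Ik; rewrite nv_setn_neq.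
Qed.

Lemma wp_brute (a : astate R) : (0 < n)%N -> (n ^ n <= M)%N -> nv a 0 = n -> xr a 0 = inp ->
  wp M brute (fun a' => is_min (n ^ n) (fun s => cost n d0 d1 ff
     (fun i => class_mean n d0 d1 (digit n s) (digit n s i))) (xr a' 5 0)) a.
Proof.
move=> n0 nM a0 ax.
have leM : (n <= M)%N by apply: leq_trans nM; rewrite -{1}(expn1 n) leq_pexp2l.
apply: wp_seq; apply: (wp_frame (wp_power (N := n) _ _ _)) => // a1 [Fn1 Fx1] e1.
have {e1}n1 : nv a1 1 = (n ^ n)%N by rewrite e1 a0.
have {}a0 : nv a1 0 = n by rewrite Fn1.
have {}ax : xr a1 0 = inp by rewrite Fx1.
set F := fun s : nat => cost _ _ _ _ _.
apply: (@wp_for _ _ (n ^ n) (fun s a' => (0 < s)%N -> is_min s F (xr a' 5 0))) => //;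
  last first.
  by move=> a' _; apply; rewrite expn_gt0 n0.
move=> s a2 sn [Fn2 Fx2] Is.
apply: wp_seq; apply: wp_setn; set a3 := setn _ 4 _.
have a03 : nv a3 0 = n by rewrite /a3 /= Fn2.
have ax3 : xr a3 0 = inp by rewrite /a3 /= Fx2.
have s3 : nv a3 3 = s by [].
have b3 : xr a3 5 0 = xr a2 5 0 by [].
have r3 : nv a3 4 = s by [].
move: a3 a03 ax3 s3 b3 r3 => a3 a03 ax3 s3 b3 r3.
apply: wp_seq; apply: (@wp_for _ _ n (fun k a' => nv a' 4 = s %/ n ^ k /\
   forall i, (i < k)%N -> xr a' 1 i = (digit n s i)%:R)%N) => //.
- by rewrite expn0 divn1.
- move=> k a4 kn [Fn4 Fx4] [I1 I2].
  apply: wp_seq; apply: wp_frame; first apply: wp_divide => //=.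
  + by rewrite Fn4 // a03.
  + rewrite I1; apply: leq_trans (leq_div _ _) _; apply: leq_trans nM; exact: ltnW.
  move=> a5 [Fn5 Fx5] /= e5.
  have e04 : nv a4 0 = n by rewrite Fn4.
  have e05 : nv a5 0 = n by rewrite Fn5.
  rewrite e04 I1 -divnMA -expnSr in e5.
  apply: wp_seq; apply: wp_setx; apply: wp_setn; split=> [|i]; first by [].
  rewrite /= e05 (Fn5 2%N) // (Fn5 4%N) //= I1 e5 Fx5 //=.
  case: (eqVneq i k) => [->|ik] ik1; last by rewrite I2 //; lia.
  by rewrite digitE.
move=> a4 [Fn4 Fx4] [_ cls].
apply: wp_seq; apply: wp_setx.
set a5 := setx _ 2 _ _.
have {}cls i : (i < n)%N -> xr a5 1 i = (digit n s i)%:R by exact: cls.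
have a05 : nv a5 0 = n by rewrite /a5 /= Fn4.
have ax5 : xr a5 0 = inp by rewrite /a5 /= Fx4.
have s5 : nv a5 3 = s by rewrite /a5 /= Fn4.
have b5 : xr a5 5 0 = xr a2 5 0 by rewrite /a5 /= Fx4.
have c5 : xr a5 2 0 = 0 by [].
move: a5 a05 ax5 s5 b5 c5 cls => a5 a05 ax5 s5 b5 c5 cls.
apply: wp_seq; apply: (@wp_for _ _ n (fun k a' => xr a' 2 0%N =
  \sum_(i < k) (d0 i + d1 i) *
    `|ff i - class_mean n d0 d1 (digit n s) (digit n s i)|)) => //.
- by rewrite big_ord0.
- move=> k a6 kn [Fn6 Fx6] I6.
  apply: wp_seq; apply: wp_setx; apply: wp_seq; apply: wp_setx.
  apply: wp_seq; apply: (@wp_for _ _ n (fun l a' =>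
    xr a' 3 0%N = \sum_(i < l | digit n s i == digit n s k) (d0 i + d1 i) /\
    xr a' 4 0%N = \sum_(i < l | digit n s i == digit n s k) d1 i)) => //.
  + by rewrite /= Fn6.
  + by rewrite !big_ord0.
  + move=> l a7 ln [Fn7 Fx7] [I71 I72].
    have x7 : xr a7 0 = inp by rewrite Fx7 //= Fx6.
    have n7 : nv a7 0 = n by rewrite Fn7 //= Fn6.
    have k7 : nv a7 2 = k by rewrite Fn7.
    have x17 i : (i < n)%N -> xr a7 1 i = (digit n s i)%:R.
      by move=> i_n; rewrite Fx7 //= Fx6 // cls.
    have cE : ceval (setn a7 7 l) (CAnd (CLeX (XR 1 (NV 7)) (XR 1 (NV 2)))
                  (CLeX (XR 1 (NV 2)) (XR 1 (NV 7)))) = (digit n s l == digit n s k).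
      by rewrite /= k7 !x17 // !ler_nat eqn_leq.
    have /= e1 := sum_recr_cond l (fun i => inp i + inp (n + i)%N)
      (fun i => digit n s i == digit n s k).
    have /= e2 := sum_recr_cond l (fun i => inp (n + i)%N)
      (fun i => digit n s i == digit n s k).
    apply: wp_if; rewrite cE => h.
      apply: wp_seq; apply: wp_setx; apply: wp_setx => /=.
      by rewrite I71 I72 x7 n7 e1 e2 h.
    by rewrite /= e1 e2 (negbTE h) !addr0.
  move=> a7 [Fn7 Fx7] [I71 I72]; apply: wp_add_abs => /=.
  have x7 : xr a7 0 = inp by rewrite Fx7 //= Fx6.
  have n7 : nv a7 0 = n by rewrite Fn7 //= Fn6.
  have k7 : nv a7 2 = k by rewrite Fn7.
  by rewrite I71 I72 x7 n7 k7 Fx7 //= I6 big_ord_recr.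
move=> a6 [Fn6 Fx6] I6; apply: wp_frame; last by move=> a' _ h _; exact: h.
apply: (@wp_update_min _ _ _ _ _ s) => //=.
- by rewrite Fn6.
- by rewrite Fx6 // b5.
Qed.

End Brute.

(** * Dynamic program over rounded masses *)

Lemma ltn_sum_digits g m (c : nat -> nat) : (forall j, (j < m)%N -> (c j < g)%N) ->
  (\sum_(j < m) c j * g ^ j < g ^ m)%N.
Proof.
elim: m => [|m IH] h; first by rewrite big_ord0.
rewrite big_ord_recr /= expnS; have := IH (fun j jm => h j (ltnW jm)).
have := h m (leqnn _); move: (g ^ m)%N (\sum_(_ < _) _)%N; nia.
Qed.

Lemma digit_sum g m (c : nat -> nat) j : (forall j, (j < m)%N -> (c j < g)%N) ->
  (j < m)%N -> digit g (\sum_(j < m) c j * g ^ j) j = c j.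
Proof.
elim: m => [//|m IH] h; have h' j' (jm : (j' < m)%N) := h j' (ltnW jm).
rewrite ltnS leq_eqVlt big_ord_recr /= /digit => /orP[/eqP ->|jm].
  rewrite divnDMl ?expn_gt0 ?(leq_ltn_trans _ (h m (leqnn _))) //.
  by rewrite divn_small ?ltn_sum_digits // add0n modn_small // h.
have g0 : (0 < g)%N by exact: leq_ltn_trans (h' _ jm).
have -> : (c m * g ^ m = c m * g ^ (m - j.+1) * g * g ^ j)%N.
  by rewrite -!mulnA -expnS -expnD; congr (_ * g ^ _)%N; lia.
by rewrite divnDMl ?expn_gt0 ?g0 // addnC modnMDl; exact: IH.
Qed.

Section DynamicProgram.
Variables (R : realType) (m W : nat).
Variables (w : nat -> nat -> nat) (c : nat -> nat -> R) (fin : nat -> R).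

Definition code (i : nat) (a : nat -> nat) : nat := \sum_(l < i) w l (a l).
(** A separable cost plus a function of the accumulated code. [s] stands for what the points from
    [i] on have contributed to the code. *)
Definition payoff (i s : nat) (a : nat -> nat) : R :=
  fin (s + code i a)%N + \sum_(l < i) c l (a l).

(* [T] is the table after [i] rounds. *)
Definition dp_inv (i : nat) (T : nat -> R) : Prop :=
  forall s, (forall a, (forall l, (l < i)%N -> (a l < m)%N) -> (s + code i a < W)%N) ->
    (exists2 a, (forall l, (l < i)%N -> (a l < m)%N) & T s = payoff i s a) /\
    forall a, (forall l, (l < i)%N -> (a l < m)%N) -> T s <= payoff i s a.

Lemma dp_inv0 T : (forall s, (s < W)%N -> T s = fin s) -> dp_inv 0 T.
Proof.
move=> h s hs; have e a : T s = payoff 0 s a.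
  rewrite /payoff /code !big_ord0 addn0 addr0 h //.
  by have := hs (fun=> 0%N); rewrite /code big_ord0 addn0; apply.
by split=> [|a _]; [exists (fun=> 0%N) | rewrite (e a)].
Qed.

Lemma codeS i a : code i.+1 a = (code i a + w i (a i))%N.
Proof. by rewrite /code big_ord_recr. Qed.

Lemma payoffS i s a : payoff i.+1 s a = payoff i (s + w i (a i)) a + c i (a i).
Proof.
rewrite /payoff codeS big_ord_recr /= addrA; congr (fin _ + _ + _).
by rewrite addnA addnAC.
Qed.

Lemma dp_invS i T T' : (0 < m)%N -> dp_inv i T ->
  (forall s, (s < W)%N -> is_min m (fun j => T (s + w i j)%N + c i j) (T' s)) ->
  dp_inv i.+1 T'.
Proof.
move=> m0 hT hT' s hs.
pose ext a j l := if l == i then j else a l : nat.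
have ext_i a j : ext a j i = j by rewrite /ext eqxx.
have ext_lt a j : (forall l, (l < i)%N -> (a l < m)%N) -> (j < m)%N ->
    forall l, (l < i.+1)%N -> (ext a j l < m)%N.
  move=> ha jm l; rewrite /ext ltnS leq_eqVlt; case: eqP => //= _; exact: ha.
have code_ext a j : code i (ext a j) = code i a.
  apply: eq_bigr => l _; rewrite /ext; case: eqP => // e.
  by have := ltn_ord l; rewrite e ltnn.
have sum_ext a j : \sum_(l < i) c l (ext a j l) = \sum_(l < i) c l (a l).
  apply: eq_bigr => l _; rewrite /ext; case: eqP => // e.
  by have := ltn_ord l; rewrite e ltnn.
have hsj j : (j < m)%N -> forall a, (forall l, (l < i)%N -> (a l < m)%N) ->
    (s + w i j + code i a < W)%N.
  move=> jm a ha; have := hs _ (ext_lt a j ha jm).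
  by rewrite codeS code_ext ext_i addnA addnAC.
have sW : (s < W)%N by have := hsj 0%N m0 (fun=> 0%N) (fun _ _ => m0); lia.
have [[j jm ej] hj] := hT' s sW; split.
  have [[a ha ea] _] := hT _ (hsj j jm).
  exists (ext a j); first exact: ext_lt.
  by rewrite payoffS ext_i ej ea /payoff code_ext sum_ext.
move=> a ha; rewrite payoffS; have ai := ha i (leqnn _).
apply: le_trans (hj _ ai) _; rewrite lerD2r.
have [_] := hT _ (hsj _ ai); apply=> l li; exact: ha (ltnW li).
Qed.

End DynamicProgram.

(** * Packing the level masses into one table index *)

Section DpObjective.
Variables (R : realType) (n : nat) (d0 d1 f : nat -> R).
Hypothesis d_ge0 : forall i, (i < n)%N -> 0 <= d0 i /\ 0 <= d1 i.
Hypothesis D_sum1 : \sum_(i < n) (d0 i + d1 i) = 1.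
Variables (K M : nat).
Hypotheses (K_gt0 : (0 < K)%N) (M_gt0 : (0 < M)%N).

Let B := M.+1.
Let G := (B * B)%N.
Let W := (G ^ K.+1)%N.

Definition floor_zeros (i : nat) : nat := Num.truncn (M%:R * d0 i).
Definition floor_ones (i : nat) : nat := Num.truncn (M%:R * d1 i).

(** The state is a number in base (M + 1)^2 whose digit [j] is the pair of masses of level [j],
    itself written in base M + 1. Putting point [i] into level [j] adds its two floors there. *)
Definition dp_weight (i j : nat) : nat :=
  ((floor_zeros i + M.+1 * floor_ones i) * (M.+1 * M.+1) ^ j)%N.
Definition dp_cost (i j : nat) : R := (d0 i + d1 i) * `|f i - j%:R / K%:R|.
Definition dp_final_value (s : nat) : R :=
  \sum_(j < K.+1) imbalance R K M j
     (digit (M.+1 * M.+1) s j %% M.+1) (digit (M.+1 * M.+1) s j %/ M.+1).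

Lemma floor_zerosP i : (i < n)%N -> (floor_zeros i)%:R <= M%:R * d0 i < (floor_zeros i).+1%:R.
Proof.
by move=> /d_ge0[h _]; apply: Num.Theory.truncn_itv; rewrite mulr_ge0 ?ler0n.
Qed.

Lemma floor_onesP i : (i < n)%N -> (floor_ones i)%:R <= M%:R * d1 i < (floor_ones i).+1%:R.
Proof.
by move=> /d_ge0[_ h]; apply: Num.Theory.truncn_itv; rewrite mulr_ge0 ?ler0n.
Qed.

(** The total mass is 1, so floors of M-fold masses add up to at most M. Hence no digit ever
    carries, and the packed state can be decoded. *)
Lemma sum_floor_lt (P : pred nat) (u : bool) :
  (\sum_(i < n | P i) (if u then floor_ones i else floor_zeros i) < B)%N.
Proof.
rewrite ltnS -(ler_nat R) natr_sum.
apply: le_trans (_ : _ <= \sum_(i < n) M%:R * (d0 i + d1 i)) _; last first.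
  by rewrite -mulr_sumr D_sum1 mulr1.
rewrite [X in _ <= X](bigID (fun i : 'I_n => P i)) /= -[X in X <= _]addr0 lerD //.
  apply: ler_sum => i _; have [h0 h1] := d_ge0 (ltn_ord i).
  have /andP[e0 _] := floor_zerosP (ltn_ord i); have /andP[e1 _] := floor_onesP (ltn_ord i).
  by case: u; [apply: (le_trans e1) | apply: (le_trans e0)];
    rewrite ler_wpM2l ?ler0n // ?lerDl ?lerDr.
apply: sumr_ge0 => i _; have [h0 h1] := d_ge0 (ltn_ord i).
by rewrite mulr_ge0 ?addr_ge0 ?ler0n.
Qed.

Section Assignment.
Variable a : nat -> nat.
Hypothesis aK : forall i, (i < n)%N -> (a i < K.+1)%N.
Let P j := (\sum_(i < n | a i == j) floor_zeros i)%N.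
Let Q j := (\sum_(i < n | a i == j) floor_ones i)%N.

Let P_lt j : (P j < B)%N := sum_floor_lt (fun i => a i == j) false.
Let Q_lt j : (Q j < B)%N := sum_floor_lt (fun i => a i == j) true.

Lemma PQ_lt j : (P j + B * Q j < G)%N.
Proof. by rewrite /G; have := P_lt j; have := Q_lt j; nia. Qed.

Lemma code_dp : code dp_weight n a = (\sum_(j < K.+1) (P j + B * Q j) * G ^ j)%N.
Proof.
rewrite /code (big_classes _ xpredT (fun l => dp_weight l (a l)) aK) /=.
apply: eq_bigr => j _; rewrite mulnDl /P /Q big_distrr /= !big_distrl /= -big_split /=.
by apply: eq_bigr => i /eqP ->; rewrite /dp_weight mulnDl.
Qed.

Lemma code_dp_lt : (code dp_weight n a < W)%N.
Proof.
rewrite code_dp; apply: (@ltn_sum_digits _ _ (fun j => P j + B * Q j)%N) => j _.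
exact: PQ_lt.
Qed.

Lemma payoff_objective :
  payoff dp_weight dp_cost dp_final_value n 0 a = objective n d0 d1 f K M floor_zeros floor_ones a.
Proof.
rewrite /payoff /objective addrC; congr (_ + _); apply: eq_bigr => j _.
rewrite add0n code_dp (@digit_sum _ _ (fun j => P j + B * Q j)%N) //; last first.
  by move=> j' _; exact: PQ_lt.
rewrite [(B * _)%N]mulnC [in X in imbalance _ _ _ _ X _]addnC modnMDl divnDMl //.
by rewrite modn_small ?P_lt // divn_small ?P_lt ?add0n.
Qed.

End Assignment.

Lemma dp_objective T : dp_inv K.+1 W dp_weight dp_cost dp_final_value n T ->
  (exists2 a, (forall l, (l < n)%N -> (a l < K.+1)%N) &
     T 0%N = objective n d0 d1 f K M floor_zeros floor_ones a) /\
  forall a, (forall l, (l < n)%N -> (a l < K.+1)%N) ->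
     T 0%N <= objective n d0 d1 f K M floor_zeros floor_ones a.
Proof.
move=> /(_ 0%N)[a ha|[a ha e] h]; first by rewrite add0n code_dp_lt.
split; first by exists a; rewrite // e payoff_objective.
by move=> b hb; rewrite -payoff_objective ?h.
Qed.

Lemma dp_cost_approx T : dp_inv K.+1 W dp_weight dp_cost dp_final_value n T ->
  (forall h, cal n d0 d1 h ->
     T 0%N <= cost n d0 d1 f h + (2 / K%:R + n%:R / M%:R)) /\
  exists2 h, cal n d0 d1 h & cost n d0 d1 f h <= T 0%N + (2 / K%:R + n%:R / M%:R).
Proof.
move=> /dp_objective[[a ha e] h]; split=> [g cg|].
  have [b hb le] := objective_le_cost f d_ge0 D_sum1 K_gt0 M_gt0 floor_zerosP floor_onesP cg.
  by apply: le_trans le; exact: h.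
exists (fun i => class_mean n d0 d1 a (a i)); first exact: cal_class_mean ha.
apply: le_trans (cost_le_objective f d_ge0 K_gt0 M_gt0 floor_zerosP floor_onesP ha) _.
by rewrite e lerD2l lerDr divr_ge0 ?ler0n.
Qed.

End DpObjective.

(* Variables: 1 is K, 8 is M = nK, 11 is M + 1, 9 is (M + 1)^2 and 10 the
   table size.  Array 1 is the table. *)
Definition dp_final : prog :=
  PFor 3 (NV 10) (
    PSetX 1 (NV 3) (XN (NC 0)) ;;
    PSetN 4 (NV 3) ;;
    PFor 2 (NAdd (NV 1) (NC 1)) (
      divide 5 6 4 9 ;;
      PSetN 12 (NSub (NV 4) (NMul (NV 5) (NV 9))) ;;
      divide 13 6 12 11 ;;
      PSetN 14 (NSub (NV 12) (NMul (NV 13) (NV 11))) ;;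
      add_abs 1 (NV 3) (XDiv (XN (NC 1)) (XMul (XN (NV 1)) (XN (NV 8))))
        (XMul (XSub (XN (NV 1)) (XN (NV 2))) (XN (NV 13)))
        (XMul (XN (NV 2)) (XN (NV 14))) ;;
      PSetN 4 (NV 5))).

(** Variables 15 and 16 are the floors for the point in variable 7, 17 is their packed form and 18
    runs through the powers of the base. The table is updated in place: weights are nonnegative and
    the index ascends, so only entries not yet overwritten are read. *)
Definition dp_item : prog :=
  floor_of 15 6 8 (XMul (XN (NV 8)) (XR 0 (NV 7))) ;;
  floor_of 16 6 8 (XMul (XN (NV 8)) (ones_at (NV 7))) ;;
  PSetN 17 (NAdd (NV 15) (NMul (NV 11) (NV 16))) ;;
  PFor 3 (NV 10) (
    PSetN 18 (NC 1) ;;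
    PFor 2 (NAdd (NV 1) (NC 1)) (
      PSetX 2 (NC 0) (XR 1 (NAdd (NV 3) (NMul (NV 17) (NV 18)))) ;;
      add_abs 2 (NC 0) (mass_at (NV 7)) (f_at (NV 7)) (XDiv (XN (NV 2)) (XN (NV 1))) ;;
      update_min 3 2 2 ;;
      PSetN 18 (NMul (NV 18) (NV 9))) ;;
    PSetX 1 (NV 3) (xvar 3)).

(** The first loop finds the least K with 3 <= K eps. It stops growing within 3n rounds because the
    program is run only when n eps >= 1. *)
Definition dp : prog :=
  PSetN 1 (NC 0) ;;
  PFor 6 (NMul (NC 3) (NV 0))
    (PIf (CLeX (XN (NC 3)) (XMul (XN (NV 1)) eps_at))
       PSkip (PSetN 1 (NAdd (NV 1) (NC 1)))) ;;
  PSetN 8 (NMul (NV 0) (NV 1)) ;;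
  PSetN 11 (NAdd (NV 8) (NC 1)) ;;
  PSetN 9 (NMul (NV 11) (NV 11)) ;;
  power 10 6 9 (NAdd (NV 1) (NC 1)) ;;
  dp_final ;;
  PFor 7 (NV 0) dp_item ;;
  PSetX 5 (NC 0) (XR 1 (NC 0)).

Definition approx : prog :=
  PIf (CLeX (XN (NC 1)) (XMul (XN (NV 0)) eps_at)) dp brute.

(** * Correctness of the table program *)

Section Dp.
Variables (R : realType) (L n : nat) (inp : nat -> R).
Local Notation d0 := inp.
Local Notation d1 := (fun i => inp (n + i)%N).
Local Notation ff := (fun i => inp (2 * n + i)%N).

Section TableSize.
Variables (K M : nat).
Local Notation G := (M.+1 * M.+1)%N.
Local Notation W := (G ^ K.+1)%N.

Definition dp_env (a : astate R) : Prop :=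
  [/\ nv a 0 = n, nv a 1 = K, nv a 8 = M, nv a 11 = M.+1 & nv a 9 = G] /\
  nv a 10 = W /\ xr a 0 = inp.

Lemma dp_env_frame p a a' : dp_env a -> frame p a a' ->
  all (fun x => x \notin nwrites p) [:: 0; 1; 8; 11; 9; 10]%N ->
  0%N \notin xwrites p -> dp_env a'.
Proof.
move=> [[h1 h2 h3 h4 h5] [h6 h7]] [Fn Fx] /and5P[f1 f2 f3 f4 /and3P[f5 f6 _]] f7.
by split; first split; rewrite ?Fn ?Fx.
Qed.

Hypothesis WL : (W <= L)%N.

Hypothesis KL : (K.+1 <= L)%N.
Hypothesis ML : (M <= L)%N.

Lemma wp_dp_final a : dp_env a ->
  wp L dp_final (fun a' => forall s, (s < W)%N -> xr a' 1 s = dp_final_value R K M s) a.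
Proof.
move=> env; have [[a0 aK aM aB aG] [aW ax]] := env.
apply: (@wp_for _ _ W (fun s a' => forall u, (u < s)%N ->
   xr a' 1 u = dp_final_value R K M u)) => //.
move=> s a1 sW F1 I1.
have env1 : dp_env a1 by exact: dp_env_frame F1 _ _.
apply: wp_seq; apply: wp_setx; apply: wp_seq; apply: wp_setn.
set a2 := setn _ 4 _.
have {a0 aK aM aB aG aW ax env}env2 : dp_env a2 by exact: env1.
have s2 : nv a2 3 = s by [].
have r2 : nv a2 4 = s by [].
have t2 u : xr a2 1 u = if u == s then 0 else xr a1 1 u by [].
move: a2 env2 s2 r2 t2 => a2 env2 s2 r2 t2.
apply: (@wp_for _ _ K.+1 (fun j a' => nv a' 4 = (s %/ G ^ j)%N /\
    forall u, xr a' 1 u = if u == s then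
      \sum_(i < j) imbalance R K M i (digit G s i %% M.+1) (digit G s i %/ M.+1)
      else xr a1 1 u)) => //.
  - by rewrite /= addn1; case: env2 => -[_ -> _ _ _ _].
  - split; first by rewrite expn0 divn1.
    by move=> u; rewrite t2 big_ord0.
  - move=> j a3 jK F3 [r3 t3].
    have env3 : dp_env a3 by exact: dp_env_frame F3 _ _.
    have s3 : nv a3 3 = s by have [-> //] := F3.
    have [[a0 aK aM aB aG] [aW ax]] := env3.
    apply: wp_seq; apply: wp_frame; first apply: wp_divide => //=.
    + by rewrite aG.
    + rewrite r3; apply: leq_trans (leq_div _ _) _; apply: leq_trans WL; exact: ltnW.
    move=> a4 F4 /= q4; have [Fn4 Fx4] := F4.
    rewrite r3 aG -divnMA -expnSr in q4.
    apply: wp_seq; apply: wp_setn.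
    have -> : neval a4 (NSub (NV 4) (NMul (NV 5) (NV 9))) = digit G s j.
      by rewrite /= q4 !Fn4 //= r3 aG digitE.
    have dL : (digit G s j <= L)%N.
      apply: leq_trans (leq_mod _ _) _; apply: leq_trans (leq_div _ _) _.
      by apply: leq_trans WL; exact: ltnW.
    apply: wp_seq; apply: wp_frame; first apply: wp_divide => //=.
    + by rewrite Fn4 //= aB.
    move=> a5 F5 /= q5; have [Fn5 Fx5] := F5.
    rewrite Fn4 //= aB in q5.
    apply: wp_seq; apply: wp_setn.
    have -> : neval a5 (NSub (NV 12) (NMul (NV 13) (NV 11))) = (digit G s j %% M.+1)%N.
      by rewrite /= q5 !Fn5 //= Fn4 //= aB {1}(divn_eq (digit G s j) M.+1) addKn.
    apply: wp_seq; apply: wp_add_abs; apply: wp_setn => /=; split.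
      by rewrite Fn5 //= q4.
    move=> u; rewrite q5 !Fn5 //= !Fn4 //= Fx5 //= Fx4 //= !t3 s3 aK aM eqxx.
    case: eqP => // _; rewrite big_ord_recr /=; congr (_ + _).
    by rewrite /imbalance mulrC div1r.
move=> a3 F3 [_ t3] u; rewrite ltnS leq_eqVlt t3.
by case: eqP => [-> //|_] /= us; rewrite I1.
Qed.

Lemma wp_dp_item a i (T : nat -> R) : (0 < M)%N -> dp_env a -> nv a 7 = i -> (i < n)%N ->
  0 <= d0 i <= 1 -> 0 <= d1 i <= 1 -> xr a 1 = T ->
  wp L dp_item (fun a' => forall s, (s < W)%N ->
    is_min K.+1 (fun j => T (s + dp_weight d0 d1 M i j)%N + dp_cost d0 d1 ff K i j)
      (xr a' 1 s)) a.
Proof.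
move=> M0 env a7 i_n /andP[p0 p1] /andP[q0 q1] aT.
have [[a0 aK aM aB aG] [aW ax]] := env.
have M0' : 0 <= M%:R :> R by rewrite ler0n.
apply: wp_seq; apply: wp_frame; first apply: (@wp_floor _ _ _ _ _ _ _ (M%:R * d0 i)) => //.
- by move=> a' [Fn Fx] /=; rewrite !Fn // Fx // aM a7 ax.
- by rewrite aM mulr_ge0 //= ler_piMr.
- by rewrite aM.
move=> a1 F1 /= c1; have [Fn1 Fx1] := F1.
apply: wp_seq; apply: wp_frame; first apply: (@wp_floor _ _ _ _ _ _ _ (M%:R * d1 i)) => //.
- by move=> a' [Fn Fx] /=; rewrite !Fn // Fx // !Fn1 // Fx1 // aM a7 ax a0.
- by rewrite Fn1 // aM mulr_ge0 //= ler_piMr.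
- by rewrite Fn1 // aM.
move=> a2 F2 /= c2; have [Fn2 Fx2] := F2.
have e15 : nv a2 15 = floor_zeros d0 M i.
  rewrite Fn2 //; apply/esym/eqP; rewrite /floor_zeros Num.Theory.truncn_eq ?mulr_ge0 //.
have e16 : nv a2 16 = floor_ones d1 M i.
  by apply/esym/eqP; rewrite /floor_ones Num.Theory.truncn_eq ?mulr_ge0.
apply: wp_seq; apply: wp_setn; set a3 := setn _ 17 _.
have env3 : dp_env a3.
  have e1 : dp_env a1 by exact: dp_env_frame F1 _ _.
  have e2 : dp_env a2 by exact: dp_env_frame F2 _ _.
  exact: e2.
have a37 : nv a3 7 = i by rewrite /= Fn2 // Fn1.
have a317 : nv a3 17 = (floor_zeros d0 M i + M.+1 * floor_ones d1 M i)%N.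
  by rewrite /a3 /= e15 e16 Fn2 // Fn1 // aB.
have t3 : xr a3 1 = T by rewrite /a3 /= Fx2 // Fx1.
move: a3 env3 a37 a317 t3 => {env a0 aK aM aB aG aW ax} a3 env3 a37 a317 t3.
set F := fun s j => T (s + dp_weight d0 d1 M i j)%N + dp_cost d0 d1 ff K i j.
apply: (@wp_for _ _ W (fun s a' => (forall u, (u < s)%N -> is_min K.+1 (F u) (xr a' 1 u))
  /\ forall u, (s <= u)%N -> xr a' 1 u = T u)) => //.
- by case: env3 => _ [].
- by split=> // u _; rewrite t3.
- move=> s a4 sW F4 [I41 I42]; have [Fn4 Fx4] := F4.
  have env4 : dp_env a4 by exact: dp_env_frame F4 _ _.
  apply: wp_seq; apply: wp_setn; apply: wp_seq.
  apply: wp_frame.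
    apply: (@wp_for _ _ K.+1 (fun j a' => nv a' 18 = (G ^ j)%N /\
       ((0 < j)%N -> is_min j (F s) (xr a' 3 0)))
       _ _ _ (fun a' => is_min K.+1 (F s) (xr a' 3 0))) => //.
    + by rewrite /= addn1; case: env4 => -[_ -> _ _ _ _].
    + move=> j a5 jK F5 [I51 I52]; have [Fn5 Fx5] := F5.
      have env5 : dp_env a5 by exact: dp_env_frame F5 _ _.
      have [[a0 aK aM aB aG] [aW ax]] := env5.
      apply: wp_seq; apply: wp_setx; apply: wp_seq; apply: wp_add_abs => /=.
      set a6 := setx _ 2 _ _.
      have f7 : nv a5 7 = i by rewrite Fn5 //= Fn4.
      have f17 : nv a5 17 = (floor_zeros d0 M i + M.+1 * floor_ones d1 M i)%N.
        by rewrite Fn5 //= Fn4.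
      have f3 : nv a5 3 = s by rewrite Fn5.
      have c6 : xr a6 2 0 = F s j.
        have e : (nv a5 3 + nv a5 17 * nv a5 18 = s + dp_weight d0 d1 M i j)%N.
          by rewrite f3 f17 I51.
        have t5 : xr a5 1 = xr a4 1 by rewrite Fx5.
        rewrite /a6 /= e t5 I42 ?leq_addr // ax a0 aK f7.
        exact: erefl.
      have m6 : (0 < j)%N -> is_min j (F s) (xr a6 3 0) by exact: I52.
      apply: wp_seq; apply: wp_frame; first exact: (@wp_update_min _ _ _ _ _ j (F s)).
      move=> a7' [Fn7 Fx7] m7; apply: wp_setn; split=> [|_]; last exact: m7.
      by rewrite /= !Fn7 //= I51 aG expnSr.
    + by move=> a5 _ [_]; apply.
  move=> a5 [Fn5 Fx5] m5; apply: wp_setx.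
  have s5 : nv a5 3 = s by rewrite Fn5.
  have t5 : xr a5 1 = xr a4 1 by rewrite Fx5.
  split=> u /=; rewrite s5 t5.
    by rewrite ltnS leq_eqVlt; case: eqP => [-> //|_] /= us; exact: I41.
  move=> su; case: eqP => [e|_]; first by rewrite e ltnn in su.
  exact: I42 (ltnW su).
- by move=> a4 _ [h _].
Qed.

End TableSize.

Hypothesis n_gt0 : (0 < n)%N.
Hypothesis d_ge0 : forall i, (i < n)%N -> 0 <= d0 i /\ 0 <= d1 i.
Hypothesis D_sum1 : \sum_(i < n) (d0 i + d1 i) = 1.

Lemma mass_le1 i : (i < n)%N -> 0 <= d0 i <= 1 /\ 0 <= d1 i <= 1.
Proof.
move=> i_n; have [h0 h1] := d_ge0 i_n; rewrite h0 h1 /=.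
have le : d0 i + d1 i <= 1.
  rewrite -D_sum1 (bigD1 (Ordinal i_n)) //= lerDl; apply: sumr_ge0 => j _.
  by have [? ?] := d_ge0 (ltn_ord j); rewrite addr_ge0.
by split; apply: le_trans le; rewrite ?lerDl ?lerDr.
Qed.

Lemma wp_dp (a : astate R) (K : nat) (eps : R) : nv a 0 = n -> xr a 0 = inp ->
  inp (3 * n)%N = eps -> 0 < eps -> 1 <= n%:R * eps ->
  3 <= K%:R * eps -> K.-1%:R * eps < 3 ->
  (((n * K).+1 * (n * K).+1) ^ K.+1 <= L)%N -> (K.+1 <= L)%N ->
  (3 * n <= L)%N -> (n * K <= L)%N ->
  wp L dp (fun a' => exists2 T, dp_inv K.+1 (((n * K).+1 * (n * K).+1) ^ K.+1)
     (dp_weight d0 d1 (n * K)) (dp_cost d0 d1 ff K) (dp_final_value R K (n * K)) n T &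
     xr a' 5 0 = T 0%N) a.
Proof.
move=> a0 ax eE eps0 neps K3 K3' WL KL nL ML.
have K0 : (0 < K)%N.
  by case: (posnP K) => // e; move: K3; rewrite e mul0r; lra.
apply: wp_seq; apply: wp_setn; apply: wp_seq.
apply: (@wp_for _ _ (3 * n)%N (fun k a' => nv a' 1 = minn k K)) => //=.
- by rewrite a0.
- by rewrite min0n.
- move=> k a1 kn [Fn1 Fx1] I1; apply: wp_if => /=; rewrite I1 Fx1 // (Fn1 0%N) //= a0 ax eE.
    move=> h; have : ~ (minn k K <= K.-1)%N.
      move=> h'; suff : 3 <= K.-1%:R * eps by rewrite leNgt K3'.
      by apply: le_trans h _; rewrite ler_wpM2r ?ler_nat // ltW.
    by move=> ?; rewrite /wp /= I1; lia.
  move=> h; have : ~ (K <= minn k K)%N.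
    move=> h'; move/negP: h; apply; apply: (le_trans K3).
    by rewrite ler_wpM2r ?ler_nat // ltW.
  by move=> ?; apply: wp_setn => /=; rewrite I1; lia.
move=> a1 [Fn1 Fx1] I1.
have K3n : (K <= 3 * n)%N.
  rewrite leqNgt; apply/negP => lt; have : (3 * n <= K.-1)%N by lia.
  rewrite -(ler_nat R) => h; suff : 3 <= K.-1%:R * eps by rewrite leNgt K3'.
  apply: le_trans (_ : (3 * n)%:R * eps <= _); last by rewrite ler_wpM2r // ltW.
  by rewrite natrM -mulrA ler_peMr.
have {}I1 : nv a1 1 = K by rewrite I1; exact/minn_idPr.
have {}a0 : nv a1 0 = n by rewrite Fn1.
have {}ax : xr a1 0 = inp by rewrite Fx1.
apply: wp_seq; apply: wp_setn; apply: wp_seq; apply: wp_setn; apply: wp_seq; apply: wp_setn.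
set a2 := setn _ 9 _.
have [b0 bK bM bB bG] : [/\ nv a2 0 = n, nv a2 1 = K, nv a2 8 = (n * K)%N,
   nv a2 11 = (n * K).+1 & nv a2 9 = ((n * K).+1 * (n * K).+1)%N].
  by rewrite /a2 /= a0 I1 addn1.
have bx : xr a2 0 = inp by [].
move: a2 b0 bK bM bB bG bx => {a1 Fn1 Fx1 I1 a0 ax} a2 b0 bK bM bB bG bx.
apply: wp_seq; apply: wp_frame; first apply: (@wp_power _ _ _ _ _ _ _ K.+1) => //.
- by move=> k /=; rewrite bK addn1.
move=> a3 F3 /= e3; have [Fn3 Fx3] := F3.
have env3 : dp_env K (n * K) a3.
  by split; first (by split; rewrite Fn3); rewrite e3 bG Fx3.
have M0 : (0 < n * K)%N by rewrite muln_gt0 n_gt0.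
apply: wp_seq; apply: wp_frame; first exact: wp_dp_final env3.
move=> a4 F4 T4.
have env4 : dp_env K (n * K) a4 by exact: dp_env_frame F4 _ _.
set inv := dp_inv K.+1 _ _ _ _.
apply: wp_seq.
apply: (@wp_for _ _ n (fun i a' => inv i (xr a' 1))) => //.
- by case: env4 => -[].
- by apply: leq_trans nL; rewrite leq_pmull.
- by apply: dp_inv0 => s sW; exact: T4.
- move=> i a5 i_n F5 I5.
  have env5 : dp_env K (n * K) a5 by exact: dp_env_frame F5 _ _.
  have [h0 h1] := mass_le1 i_n.
  apply: wp_frame; first exact: (@wp_dp_item K (n * K) WL KL ML (setn a5 7 i) i _ M0).
  by move=> a6 F6; apply: dp_invS I5.
by move=> a5 F5 I5; apply: wp_setx; exists (xr a5 1).
Qed.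

End Dp.

(* The test [1 <= eps] comes before the input is copied, as only constant time
   is available in that case. *)
Definition approx_alg : cmd :=
  If (BLeR (RCast (IConst 1)) (RCell (IMul (IConst 3) (ICell (IConst 0)))))
     (RSet (IConst 0) (RCast (IConst 0)))
     (run approx 5).

Definition approx_degree : nat := maxn 1 (depth approx).
(** The power of 2 pays for the bound M <= 2 n^e on the rounds, and the excess of 100 over the
    constant of [run_sound] for the initial test. *)
Definition approx_constant : nat := (tbound 1 approx + 700) * 2 ^ approx_degree.

(** * Accuracy and running time of the approximation algorithm *)

Section Approx.
Variables (R : realType) (X : finType) (D : fdist R (X * bool)%type) (f : X -> R).
Variable eps : R.
Hypothesis eps_gt0 : 0 < eps.
Local Notation n := #|X|.
Local Notation inp := (rmem (input D f [:: eps])).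
Local Notation d0 := inp.
Local Notation d1 := (fun i => inp (n + i)%N).
Local Notation ff := (fun i => inp (2 * n + i)%N).

Lemma inp_eps : inp (3 * n)%N = eps.
Proof. by rewrite -[(3 * n)%N]addn0 inp_params. Qed.

Lemma exists_K : exists2 K : nat, 3 <= K%:R * eps & K.-1%:R * eps < 3.
Proof.
have ex : exists k : nat, 3 <= k%:R * eps.
  exists (Num.truncn (3 / eps)).+1; rewrite -ler_pdivrMr // ltW //.
  exact: Num.Theory.truncnS_gt.
case: (ex_minnP ex) => K K3 Kmin; exists K => //.
case: K K3 Kmin => [|K] K3 Kmin /=; first by rewrite mul0r.
by rewrite ltNge; apply/negP => /Kmin; rewrite ltnn.
Qed.

(** The level sets of a calibrated predictor form an assignment of equal cost, whose code in base n
    is among those tried; conversely, class means are calibrated. So the minimum is exact. *)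
Lemma brute_min v :
  is_min (n ^ n) (fun s => cost n d0 d1 ff
     (fun i => class_mean n d0 d1 (digit n s) (digit n s i))) v ->
  v = CalDist D f.
Proof.
move=> [[s sn ev] hv]; have n0 := card_X_gt0 D.
apply/eqP; rewrite -subr_eq0 -normr_le0.
apply: (@CalDist_approx _ _ _ _ [:: eps]) => [h ch|].
  pose a := level n h.
  have an j : (j < n)%N -> (a j < n)%N by exact: level_lt.
  rewrite addr0 -(cost_level ff (@inp_ge0 _ _ D f _) ch).
  set t := (\sum_(j < n) a j * n ^ j)%N.
  have dt j : (j < n)%N -> digit n t j = a j by exact: digit_sum.
  have tn : (t < n ^ n)%N by exact: ltn_sum_digits.
  apply: (le_trans (hv t tn)); rewrite le_eqVlt; apply/orP; left; apply/eqP.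
  apply: eq_bigr => i _; congr (_ * `| _ - _ |); rewrite dt // /class_mean.
  by congr (_ / _); apply: eq_bigl => k; rewrite dt.
exists (fun i => class_mean n d0 d1 (digit n s) (digit n s i)).
  apply: (@cal_class_mean _ _ _ _ (@inp_ge0 _ _ D f _) n) => i _.
  by rewrite /digit ltn_pmod.
by rewrite addr0 ev.
Qed.

Lemma approx_small : eps < 1 -> exists t v (e : nat),
  [/\ computes_in approx_alg (input D f [:: eps]) t v,
      `|v - CalDist D f| <= eps, (t <= approx_constant * n ^ e)%N
    & e%:R <= (40 * approx_degree)%:R / eps].
Proof.
move=> eps1; have n0 := card_X_gt0 D.
have guard : ~~ beval (input D f [:: eps])
    (BLeR (RCast (IConst 1)) (RCell (IMul (IConst 3) (ICell (IConst 0))))).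
  rewrite [beval _ _]/= -[nth 0 _ _]/(inp _) inp_eps -ltNge.
  exact: eps1.
have dn : (40 * approx_degree)%:R / eps = 40 * (approx_degree%:R / eps) :> R.
  by rewrite natrM mulrA.
have dge0 : 0 <= approx_degree%:R :> R by rewrite ler0n.
suff main M e Q : (n < M)%N -> (M <= 2 * n ^ e)%N -> e%:R <= 40 / eps ->
    (forall a, nv a 0 = n -> xr a 0 = inp -> wp M approx Q a) ->
    (forall a, Q a -> `|xr a 5 0 - CalDist D f| <= eps) ->
    exists t v (e : nat),
  [/\ computes_in approx_alg (input D f [:: eps]) t v,
      `|v - CalDist D f| <= eps, (t <= approx_constant * n ^ e)%N
    & e%:R <= (40 * approx_degree)%:R / eps].
  have [neps|neps] := lerP 1 (n%:R * eps).
    have n1 : (1 < n)%N.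
      rewrite ltnNge; apply/negP => n1; have e1 : n = 1%N by lia.
      by move: neps; rewrite e1 mul1r leNgt eps1.
    have [K K3 K3'] := exists_K.
    have K0 : (0 < K)%N by case: (posnP K) => // e; move: K3; rewrite e mul0r; lra.
    have Kn : (K <= 3 * n)%N.
      rewrite leqNgt; apply/negP => lt; have : (3 * n <= K.-1)%N by lia.
      rewrite -(ler_nat R) => h; suff : 3 <= K.-1%:R * eps by rewrite leNgt K3'.
      apply: le_trans (_ : (3 * n)%:R * eps <= _); last by rewrite ler_wpM2r // ltW.
      by rewrite natrM -mulrA ler_peMr.
    set B := (n * K).+1.
    have BB : (B * B <= (B * B) ^ K.+1)%N by rewrite -{1}[(B * B)%N]expn1 leq_pexp2l.
    (* From K <= 3n and n >= 2: nK + 1 <= 3n^2 + 1 <= n^4. *)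
    have B_le : (B <= n ^ 4)%N.
      have h4 : (4 <= n ^ 2)%N by exact: (leq_mul n1 n1).
      have hK : (n * K <= 3 * n ^ 2)%N by rewrite mulnCA leq_mul2l Kn orbT.
      rewrite -[4%N]/(2 + 2)%N expnD /B; move: (n * K)%N (n ^ 2)%N h4 hK; nia.
    have [l1 l2 l3 l4] : [/\ (K.+1 <= B * B)%N, (3 * n <= B * B)%N, (n * K <= B * B)%N
        & (n < B * B)%N].
      by rewrite /B; split; nia.
    apply: (main ((B * B) ^ K.+1)%N (8 * K.+1)%N).
    - exact: leq_trans l4 BB.
    - rewrite mulnC; apply: leq_trans (leq_pmulr _ _) => //.
      by rewrite expnM leq_exp2r // -[8%N]/(4 + 4)%N expnD leq_mul.
    (* (K + 1) eps = (K - 1) eps + 2 eps < 3 + 2, so the exponent 8(K + 1) is below 40/eps; this is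
       the origin of 40. *)
    - rewrite natrM ler_pdivlMr // -mulrA (_ : 40 = 8%:R * 5%:R); last by lra.
      rewrite ler_wpM2l ?ler0n //.
      have -> : K.+1%:R = K.-1%:R + 2 :> R by rewrite -natrD; congr _%:R; lia.
      by rewrite mulrDl; lra.
    - move=> a a0 ax; apply: wp_if => /=; rewrite a0 ax inp_eps; last by rewrite neps.
      move=> _; apply: (@wp_dp _ _ _ inp n0 (@inp_ge0 _ _ D f _)
         (inp_sum1 D f [:: eps]) a K eps a0 ax inp_eps eps_gt0 neps K3 K3') => //.
      + exact: leq_trans l1 BB.
      + exact: leq_trans l2 BB.
      + exact: leq_trans l3 BB.
    - move=> a [T hT ->].
      have nK : (0 < n * K)%N by rewrite muln_gt0 n0.
      have [lo hi] := dp_cost_approx (@inp_ge0 _ _ D f _) (inp_sum1 D f [:: eps]) K0 nK hT.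
      apply: le_trans (CalDist_approx lo hi) _.
      have K0' : 0 < K%:R :> R by rewrite ltr0n.
      have -> : 2 / K%:R + n%:R / (n * K)%:R = 3 / K%:R :> R.
        by rewrite natrM; field; rewrite !gt_eqF // ltr0n.
      by rewrite ler_pdivrMr // mulrC.
  (* Here n < 1/eps bounds the exponent. The successor makes the bound exceed n even when n = 1. *)
  apply: (main (n ^ n).+1 n).
  - rewrite ltnS -{1}[n in (n <= _)%N]expn1; exact: leq_pexp2l.
  - by have : (0 < n ^ n)%N by [rewrite expn_gt0 n0]; lia.
  - by rewrite ler_pdivlMr //; apply: le_trans (ltW neps) _; lra.
  - move=> a a0 ax; apply: wp_if => /=; rewrite a0 ax inp_eps; first by rewrite leNgt neps.
    by move=> _; exact: (@wp_brute _ _ _ inp a n0 (leqnSn _) a0 ax).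
  - by move=> a /brute_min ->; rewrite subrr normr0 ltW.
move=> nM Mn he hwp hQ.
have [|||t [a [[s' ex es'] ht hq]]] := @run_sound _ _ D f [:: eps] approx 5 M Q _ _ _ nM hwp.
- by [].
- by [].
- by [].
exists (bcost (BLeR (RCast (IConst 1)) (RCell (IMul (IConst 3) (ICell (IConst 0))))) + t).+1.
exists (xr a 5 0), (e * approx_degree)%N; split; last first.
- rewrite dn natrM; have := ler_wpM2r dge0 he; lra.
- apply: leq_trans (_ : ((tbound 1 approx + 700) * M ^ approx_degree <= _))%N.
    have : (0 < M ^ approx_degree)%N by rewrite expn_gt0; lia.
    rewrite -[bcost _]/8%N; move: ht; rewrite -/approx_degree.
    move: (tbound 1 approx) (M ^ approx_degree)%N => x y; nia.
  rewrite /approx_constant -mulnA leq_mul2l expnM -expnMn leq_exp2r ?Mn ?orbT //.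
- exact: hQ.
- by exists s' => //; exact: ExecIfFalse.
Qed.

(** All distances lie in [0,1], so the output 0 is within eps. A single class, with the overall mean
    as its value, supplies the calibrated predictor. *)
Lemma approx_large : predictor f -> 1 <= eps -> exists t v,
  [/\ computes_in approx_alg (input D f [:: eps]) t v,
      `|v - CalDist D f| <= eps & (t <= approx_constant)%N].
Proof.
move=> pf eps1; have n0 := card_X_gt0 D.
have guard : beval (input D f [:: eps])
    (BLeR (RCast (IConst 1)) (RCell (IMul (IConst 3) (ICell (IConst 0))))).
  rewrite [beval _ _]/= -[nth 0 _ _]/(inp _) inp_eps.
  exact: eps1.
do 2 eexists; split.
- eexists; first (apply: ExecIfTrue guard _; exact: ExecRSet).
  by rewrite /= /upd eqxx.
- apply: (@CalDist_approx _ _ _ _ [:: eps]) => [h ch|].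
    apply: addr_ge0; last exact: ltW.
    by apply: sumr_ge0 => i _; have [? ?] := @inp_ge0 _ _ D f [:: eps] _ (ltn_ord i);
      rewrite mulr_ge0 ?addr_ge0.
  exists (fun i => class_mean n d0 d1 (fun=> 0%N) 0).
    exact: (@cal_class_mean _ _ _ _ (@inp_ge0 _ _ D f _) 1 (fun=> 0%N)).
  rewrite add0r; apply: le_trans eps1; rewrite -(inp_sum1 D f [:: eps]).
  apply: ler_sum => i _; have [h0 h1] := @inp_ge0 _ _ D f [:: eps] _ (ltn_ord i).
  rewrite ler_piMr ?addr_ge0 //.
  have /andP[u0 u1] := @inp_f01 _ _ D f [:: eps] pf _ (ltn_ord i).
  have /andP[v0 v1] := class_mean01 (@inp_ge0 _ _ D f [:: eps]) (fun=> 0%N) 0.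
  by rewrite ler_norml; apply/andP; split; lra.
- rewrite /approx_constant; apply: leq_trans (leq_pmulr _ _); last by rewrite expn_gt0.
  by rewrite -[X in (X <= _)%N]/13%N; lia.
Qed.

End Approx.

Lemma approx_uniform (R : realType) (X : finType) (D : fdist R (X * bool)%type)
    (f : X -> R) (eps : R) : predictor f -> 0 < eps ->
  exists (t : nat) (v : R),
    [/\ computes_in approx_alg (input D f [:: eps]) t v,
        `|v - CalDist D f| <= eps
      & t%:R <= approx_constant%:R * #|X|%:R `^ ((40 * approx_degree)%:R / eps)].
Proof.
move=> pf eps0; have n1 : 1 <= #|X|%:R :> R by rewrite ler1n (card_X_gt0 D).
have [eps1|eps1] := lerP 1 eps.
  have [t [v [h1 h2 h3]]] := approx_large D eps0 pf eps1; exists t, v; split=> //.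
  apply: le_trans (_ : approx_constant%:R <= _); first by rewrite ler_nat.
  have b0 : 0 <= (40 * approx_degree)%:R / eps by rewrite divr_ge0 ?ler0n // ltW.
  by have := ler_powR n1 b0; rewrite powRr0 => ?; rewrite ler_peMr ?ler0n.
have [t [v [e [h1 h2 h3 h4]]]] := approx_small D f eps0 eps1.
exists t, v; split=> //.
apply: le_trans (_ : (approx_constant * #|X| ^ e)%:R <= _); first by rewrite ler_nat.
rewrite natrM natrX ler_wpM2l ?ler0n // -powR_mulrn ?ler0n //.
exact: ler_powR.
Qed.

(** For eps >= 1 the base n/eps may be below 1, but ln eps <= eps keeps (n/eps)^(B/eps) above
    exp(-B); the factor [E] >= exp(B) in the constant compensates. For eps < 1 one has n <=
    n/eps. *)
Lemma approx_general (R : realType) : exists A : nat,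
  forall (X : finType) (D : fdist R (X * bool)%type) (f : X -> R) (eps : R),
  predictor f -> 0 < eps ->
  exists (t : nat) (v : R),
    [/\ computes_in approx_alg (input D f [:: eps]) t v,
        `|v - CalDist D f| <= eps
      & t%:R <= A%:R * (#|X|%:R / eps) `^ ((40 * approx_degree)%:R / eps)].
Proof.
set B := (40 * approx_degree)%N.
set E := (Num.truncn (sequences.expR B%:R : R)).+1.
have hE : sequences.expR B%:R <= E%:R :> R by rewrite ltW // Num.Theory.truncnS_gt.
exists (approx_constant * E)%N => X D f eps pf eps0.
have n1 : 1 <= #|X|%:R :> R by rewrite ler1n (card_X_gt0 D).
have E1 : 1 <= E%:R :> R by rewrite ler1n.
have c0 : 0 <= approx_constant%:R :> R by rewrite ler0n.
have [eps1|eps1] := lerP 1 eps.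
  have [t [v [h1 h2 h3]]] := approx_large D eps0 pf eps1; exists t, v; split=> //.
  apply: le_trans (_ : approx_constant%:R <= _); first by rewrite ler_nat.
  rewrite natrM -mulrA ler_peMr //.
  apply: le_trans (_ : sequences.expR B%:R * (#|X|%:R / eps) `^ (B%:R / eps) <= _); last first.
    by rewrite ler_wpM2r ?powR_ge0.
  have q0 : 0 < #|X|%:R / eps by rewrite divr_gt0 // (lt_le_trans _ n1).
  rewrite /powR gt_eqF // -expRD.
  have h : - eps <= ln (#|X|%:R / eps).
    rewrite lnM ?posrE ?invr_gt0 // ?(lt_le_trans _ n1) // lnV ?posrE //.
    have := ln_ge0 n1; have := ln_sublinear eps0; lra.
  have B0 : 0 <= B%:R / eps by rewrite divr_ge0 ?ler0n // ltW.
  have h' : 0 <= B%:R + B%:R / eps * ln (#|X|%:R / eps).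
    by have := ler_wpM2l B0 h; rewrite mulrN divfK ?gt_eqF //; lra.
  by rewrite -[X in X <= _]expR0 ler_expR.
have [t [v [h1 h2 h3]]] := approx_uniform D pf eps0; exists t, v; split=> //.
apply: le_trans h3 _; apply: ler_pM => //; first exact: powR_ge0.
  by rewrite natrM ler_peMr.
rewrite ge0_ler_powR ?nnegrE ?divr_ge0 ?ler0n ?ltW //.
by rewrite ltr_pdivlMr // gtr_pMr // (lt_le_trans _ n1).
Qed.

(** * Uniform noiseless distributions *)

Section Noiseless.
Variables (R : realType) (T : finType) (one : pred T) (f : T -> R) (rk : T -> nat).
Hypothesis f01 : forall x, 0 <= f x <= 1.
Hypothesis rk_inj : forall x y, one x = one y -> rk x = rk y -> x = y.
Hypothesis rk_mono : forall x y, one x = one y -> (rk x <= rk y)%N -> f x <= f y.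

Definition class_size (b : bool) : nat := #|[pred x | one x == b]|.

Hypothesis rk_lt : forall x, (rk x < class_size (one x))%N.

Definition balanced (g : T -> R) : Prop :=
  forall alpha, \sum_(x | g x == alpha) ((one x)%:R - alpha) = 0.

Definition total_dist (g : T -> R) : R := \sum_x `|f x - g x|.

(** The ranks are injective on a class and bounded by its size, hence exactly 0, ..., size - 1;
    counting points becomes counting ranks. *)
Lemma card_rk_lt b k : (k <= class_size b)%N ->
  #|[pred x | (one x == b) && (rk x < k)%N]| = k.
Proof.
move=> kb; set A := [pred x | one x == b].
have rk_lt' x : x \in A -> (rk x < class_size b)%N by move=> /eqP <-; exact: rk_lt.
have rk_inj' : {in A &, injective rk}.
  by move=> x y /eqP ex /eqP ey; apply: rk_inj; rewrite ex ey.
have sz : size [seq rk x | x <- enum A] = class_size b by rewrite size_map -cardE.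
have uniq_rk : uniq [seq rk x | x <- enum A].
  rewrite map_inj_in_uniq ?enum_uniq // => x y; rewrite !mem_enum; exact: rk_inj'.
have sub : {subset [seq rk x | x <- enum A] <= iota 0 (class_size b)}.
  by move=> _ /mapP[x xA ->]; rewrite mem_iota /= add0n rk_lt' // -mem_enum.
have [_ eq_mem] := uniq_min_size uniq_rk sub (eq_leq (etrans (size_iota _ _) (esym sz))).
have perm : perm_eq [seq rk x | x <- enum A] (iota 0 (class_size b)).
  by apply: uniq_perm => //; exact: iota_uniq.
transitivity (count (fun j => j < k)%N [seq rk x | x <- enum A]).
  rewrite count_map -size_filter; have -> : [seq x <- enum A | preim rk (fun j => (j < k)%N) x]
      = [seq x <- enum T | (one x == b) && (rk x < k)%N].
    by rewrite /enum_mem -!filter_predI; apply: eq_filter => x /=; rewrite !inE andbC andbT.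
  by rewrite cardE /enum_mem -!filter_predI; congr size; apply: eq_filter => x /=; rewrite !inE andbT.
rewrite (seq.permP perm) -(subnKC kb) iotaD count_cat add0n.
rewrite (@eq_in_count _ _ predT) ?count_predT ?size_iota; last first.
  by move=> j; rewrite mem_iota add0n => /andP[_ ->].
rewrite (@eq_in_count _ _ pred0) ?count_pred0 ?addn0 //.
by move=> j; rewrite mem_iota => /andP[kj _]; rewrite /= ltnNge kj.
Qed.

(** The threshold is the least rank of a class member outside [A], or the class size if there is
    none. *)
Lemma down_closed_rk b (A : pred T) :
  (forall x y, one x = b -> one y = b -> (rk y <= rk x)%N -> A x -> A y) ->
  exists2 k, (k <= class_size b)%N & forall x, one x = b -> A x = (rk x < k)%N.
Proof.
move=> dA.
have ex : exists k, (k == class_size b) || [exists x, [&& one x == b, ~~ A x & rk x == k]].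
  by exists (class_size b); rewrite eqxx.
case: (ex_minnP ex) => k hk kmin; exists k; first by apply: kmin; rewrite eqxx.
move=> x xb; rewrite ltnNge; apply/idP/idP => [Ax|].
  apply/negP => kx; case/orP: hk => [/eqP ek|/existsP[y /and3P[/eqP yb nAy /eqP ry]]].
    by have := rk_lt x; rewrite xb -ek ltnNge kx.
  by move/negP: nAy; apply; apply: (dA x y) => //; rewrite ry.
rewrite -ltnNge => xk; apply: contraLR xk => nAx; rewrite -leqNgt; apply: kmin.
by apply/orP; right; apply/existsP; exists x; rewrite xb eqxx nAx eqxx.
Qed.

Definition below (i j : nat) (x : T) : bool :=
  if one x then (rk x < i)%N else (rk x < j)%N.

Lemma card_below b k l : (k <= class_size true)%N -> (l <= class_size false)%N ->
  #|[pred x | (one x == b) && below k l x]| = if b then k else l.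
Proof.
move=> kp lq; have kb : ((if b then k else l) <= class_size b)%N by case: (b).
rewrite -[RHS](card_rk_lt kb); apply: eq_card => x; rewrite !inE /below.
by case: (one x); case: (b).
Qed.

Lemma below_leq b k' l' k l : (k' <= class_size true)%N -> (l' <= class_size false)%N ->
  (k <= class_size true)%N -> (l <= class_size false)%N ->
  (forall x, below k' l' x -> below k l x) ->
  ((if b then k' else l') <= if b then k else l)%N.
Proof.
move=> kp' lq' kp lq h; rewrite -!card_below //.
apply: subset_leq_card; apply/fintype.subsetP => x.
by rewrite !inE => /andP[-> /h].
Qed.

Definition mean_ratio (di dj : nat) : R := di%:R / (di%:R + dj%:R).

Definition prefix_dist (b : bool) (al : R) (i : nat) : R :=
  \sum_(x | (one x == b) && (rk x < i)%N) `|f x - al|.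

(** The mean depends only on the numbers of ones and zeros in the block, so every cost is read off
    prefix sums indexed by those two numbers and a prefix length: O(n^3) entries, each computed in
    O(n). *)
Definition block_cost (i' j' i j : nat) : R :=
  let al := mean_ratio (i - i') (j - j') in
  (prefix_dist true al i - prefix_dist true al i') +
  (prefix_dist false al j - prefix_dist false al j').

Definition between (i' j' i j : nat) (x : T) : bool := below i j x && ~~ below i' j' x.

Section Block.
Variables i' j' i j : nat.
Hypotheses (le_i : (i' <= i)%N) (le_j : (j' <= j)%N).

Lemma sum_below (F : T -> R) :
  \sum_(x | below i j x) F x =
  \sum_(x | below i' j' x) F x + \sum_(x | between i' j' i j x) F x.
Proof.
rewrite (bigID (below i' j')) /=; congr (_ + _).
apply: eq_bigl => x; rewrite /below; case: (one x); apply/andP/idP => [[]//|h];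
  split=> //; lia.
Qed.

Lemma sum_below_classes k l (F : T -> R) :
  \sum_(x | below k l x) F x = \sum_(x | (one x == true) && (rk x < k)%N) F x +
     \sum_(x | (one x == false) && (rk x < l)%N) F x.
Proof.
rewrite (bigID one) /=; congr (_ + _); apply: eq_bigl => x; rewrite /below;
  by case: (one x); rewrite ?andbT ?andbF.
Qed.

Lemma block_costE :
  block_cost i' j' i j = \sum_(x | between i' j' i j x) `|f x - mean_ratio (i - i') (j - j')|.
Proof.
apply: (@addrI _ (\sum_(x | below i' j' x) `|f x - mean_ratio (i - i') (j - j')|)).
rewrite -sum_below !sum_below_classes /block_cost /prefix_dist; ring.
Qed.

Hypotheses (ip : (i <= class_size true)%N) (jq : (j <= class_size false)%N).

Lemma sum_below_const k l (c1 c0 : R) :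
  (k <= class_size true)%N -> (l <= class_size false)%N ->
  \sum_(x | below k l x) (if one x then c1 else c0) = k%:R * c1 + l%:R * c0.
Proof.
move=> kp lq; rewrite sum_below_classes; congr (_ + _).
  rewrite (eq_bigr (fun=> c1)) => [|x /andP[/eqP -> _] //].
  by rewrite sumr_const card_rk_lt // mulr_natl.
rewrite (eq_bigr (fun=> c0)) => [|x /andP[/eqP -> _] //].
by rewrite sumr_const card_rk_lt // mulr_natl.
Qed.

Lemma sum_between_const (c1 c0 : R) :
  \sum_(x | between i' j' i j x) (if one x then c1 else c0) =
  (i - i')%:R * c1 + (j - j')%:R * c0.
Proof.
have := sum_below (fun x => if one x then c1 else c0).
rewrite !sum_below_const ?(leq_trans le_i) ?(leq_trans le_j) // !natrB //.
by move=> h; rewrite !mulrBl; lra.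
Qed.

Lemma sum_between_one_sub (alpha : R) :
  \sum_(x | between i' j' i j x) ((one x)%:R - alpha) =
  (i - i')%:R - alpha * ((i - i')%:R + (j - j')%:R).
Proof.
rewrite (eq_bigr (fun x => if one x then 1 - alpha else - alpha)); last first.
  by move=> x _; case: (one x); rewrite ?sub0r.
rewrite sum_between_const; ring.
Qed.

End Block.

Lemma mean_ratio01 di dj : 0 <= mean_ratio di dj <= 1.
Proof.
rewrite /mean_ratio divr_ge0 ?addr_ge0 ?ler0n //=; case: (posnP (di + dj)) => [e|pos].
  by rewrite -natrD e invr0 mulr0.
by rewrite ler_pdivrMr -?natrD ?ltr0n // mul1r ler_nat leq_addr.
Qed.

Lemma mean_ratio_mul di dj : di%:R - mean_ratio di dj * (di%:R + dj%:R) = 0.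
Proof.
rewrite /mean_ratio; case: (posnP (di + dj)) => [e|pos].
  by have -> : di = 0%N by [lia]; rewrite !mul0r subrr.
by rewrite divfK ?subrr // -natrD pnatr_eq0 -lt0n.
Qed.

Variable V : nat -> nat -> R.

(** The starting value [i + j] of the minimisation is safe: one block made of all these points costs
    at most that, and for i = j = 0 it is the true value. *)
Definition dp_cell (i j : nat) : Prop :=
  (forall i' j', (i' <= i)%N -> (j' <= j)%N -> V i j <= V i' j' + block_cost i' j' i j) /\
  (V i j = (i + j)%:R \/ exists i' j', [/\ (i' <= i)%N, (j' <= j)%N,
     (i' + j' < i + j)%N & V i j = V i' j' + block_cost i' j' i j]).

Hypothesis V_cell : forall i j, (i <= class_size true)%N -> (j <= class_size false)%N ->
  dp_cell i j.

Definition partial_solution (i j : nat) (c : R) : Prop :=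
  exists g : T -> R, [/\ forall x, 0 <= g x <= 1,
    forall alpha, \sum_(x | below i j x && (g x == alpha)) ((one x)%:R - alpha) = 0
    & \sum_(x | below i j x) `|f x - g x| <= c].

(** The old predictor is kept and the new block receives its mean. If the mean is already a value of
    the old predictor, two level sets merge, both balanced. *)
Lemma extend_solution i' j' i j c : (i' <= i)%N -> (j' <= j)%N ->
  (i <= class_size true)%N -> (j <= class_size false)%N ->
  partial_solution i' j' c -> partial_solution i j (c + block_cost i' j' i j).
Proof.
move=> li lj ip jq [g [g01 gb gc]]; set al := mean_ratio (i - i') (j - j').
exists (fun x => if below i' j' x then g x else al); split=> [x|alpha|].
- by case: ifP => _; rewrite ?mean_ratio01.
- rewrite big_mkcondr /= (sum_below li lj).
  rewrite [X in X + _](eq_bigr (fun x => if g x == alpha then (one x)%:R - alpha else 0)); last first.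
    by move=> x ->.
  rewrite -big_mkcondr gb add0r.
  rewrite (eq_bigr (fun x => if al == alpha then (one x)%:R - alpha else 0)); last first.
    by move=> x /andP[_ /negbTE ->].
  case: eqP => [<-|_]; last by rewrite big1.
  by rewrite sum_between_one_sub // mean_ratio_mul.
- rewrite (sum_below li lj) block_costE //; apply: lerD.
    by apply: le_trans gc; rewrite le_eqVlt; apply/orP; left; apply/eqP;
      apply: eq_bigr => x ->.
  rewrite le_eqVlt; apply/orP; left; apply/eqP.
  by apply: eq_bigr => x /andP[_ /negbTE ->].
Qed.

Lemma dp_attained i j : (i <= class_size true)%N -> (j <= class_size false)%N ->
  partial_solution i j (V i j).
Proof.
move: {2}(i + j).+1 (ltnSn (i + j)) => N; elim: N i j => // N IH i j ltN ip jq.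
have [_ [->|[i' [j' [li lj ltij ->]]]]] := V_cell ip jq; last first.
  by apply: extend_solution => //; apply: IH; lia.
have sol0 : partial_solution 0 0 0.
  exists (fun=> 0); split=> [x|alpha|]; rewrite ?lexx ?ler01 ?big_pred0 //.
    by move=> x; rewrite /below if_same ltn0.
  by move=> x; rewrite /below if_same ltn0.
(* The cell still has its starting value: a single block realises it. *)
have [g [g01 gb gc]] := extend_solution (leq0n i) (leq0n j) ip jq sol0.
exists g; split=> //; apply: (le_trans gc); rewrite add0r block_costE //.
apply: le_trans (_ : _ <= \sum_(x | between 0 0 i j x) (if one x then 1 else 1)) _.
  apply: ler_sum => x _; rewrite if_same.
  have := f01 x; have := mean_ratio01 (i - 0) (j - 0).
  by move=> /andP[? ?] /andP[? ?]; rewrite ler_norml; apply/andP; split; lra.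
by rewrite sum_between_const // !subn0 !mulr1 -natrD.
Qed.

Lemma below_all x : below (class_size true) (class_size false) x.
Proof. by rewrite /below; have := rk_lt x; case: (one x). Qed.

Lemma exists_balanced : exists g : T -> R, [/\ forall x, 0 <= g x <= 1, balanced g
  & total_dist g <= V (class_size true) (class_size false)].
Proof.
have [g [g01 gb gc]] := dp_attained (leqnn _) (leqnn _); exists g; split=> //.
  by move=> alpha; rewrite -[RHS](gb alpha); apply: eq_bigl => x; rewrite below_all.
by apply: le_trans gc; rewrite (eq_bigl _ _ below_all).
Qed.

Section Monotone.
Variable g : T -> R.
Hypothesis g01 : forall x, 0 <= g x <= 1.
Hypothesis g_bal : balanced g.
Hypothesis g_mono : forall x y, one x = one y -> (rk x <= rk y)%N -> g x <= g y.

Lemma sublevel_below w : exists i j, [/\ (i <= class_size true)%N,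
  (j <= class_size false)%N & forall x, below i j x = (g x < w)].
Proof.
have dn b x y : one x = b -> one y = b -> (rk y <= rk x)%N -> g x < w -> g y < w.
  by move=> xb yb yx; apply: le_lt_trans; apply: g_mono; rewrite ?xb ?yb.
have [i ip hi] := down_closed_rk (dn true).
have [j jq hj] := down_closed_rk (dn false).
exists i, j; split=> // x; rewrite /below; case E: (one x); first by rewrite hi.
by rewrite hj.
Qed.

(** Peel off the top level set. With [w] the largest value on the prefix, the points of smaller
    value form a prefix again because [g] is monotone, the points of value [w] form a block, and
    balance forces [w] to be the mean of that block. *)
Lemma dp_le_monotone i j c : (i <= class_size true)%N -> (j <= class_size false)%N ->
  (forall x, below i j x = (g x < c)) ->
  V i j <= \sum_(x | below i j x) `|f x - g x|.
Proof.
move: {2}(i + j).+1 (ltnSn (i + j)) => N; elim: N i j c => // N IH i j c ltN ip jq hc.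
have sum1 k l : (k <= class_size true)%N -> (l <= class_size false)%N ->
    \sum_(x | below k l x) (if one x then 1 else 1) = (k + l)%:R :> R.
  by move=> kp lq; rewrite sum_below_const // !mulr1 natrD.
case: (boolP [exists x, below i j x]) => [/existsP[x0 bx0]|/existsPn none]; last first.
  have ij0 : (i + j = 0)%N.
    apply/eqP; rewrite -(pnatr_eq0 R) -sum1 //; apply/eqP; apply: big_pred0 => x.
    exact/negbTE/none.
  rewrite big_pred0 => [|x]; last exact/negbTE/none.
  have [_ [->|[i' [j' [_ _ ]]]]] := V_cell ip jq; first by rewrite ij0.
  by rewrite ij0.
have [x1 bx1 hmax] : exists2 x1, below i j x1 & forall x, below i j x -> g x <= g x1.
  case: (arg_maxP g bx0) => x1 bx1 h; by exists x1.
set w := g x1 in hmax *.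
have [i' [j' [ip' jq' hw]]] := sublevel_below w.
have wc : w < c by rewrite -hc.
have sub x : below i' j' x -> below i j x by rewrite hw hc => /lt_trans; apply.
have bet x : (below i j x && ~~ below i' j' x) = (g x == w).
  rewrite hw -leNgt; apply/andP/eqP => [[bx wx]|e]; last by rewrite hc e lexx wc.
  by apply/eqP; rewrite eq_le wx hmax.
have li : (i' <= i)%N by exact: (below_leq true ip' jq' ip jq sub).
have lj : (j' <= j)%N by exact: (below_leq false ip' jq' ip jq sub).
have bal := g_bal w.
rewrite -(eq_bigl _ _ bet) sum_between_one_sub // in bal.
have pos : (i' + j' < i + j)%N.
  rewrite -(ltr_nat R) -!sum1 // (sum_below li lj) ltrDl lt0r; apply/andP; split.
    rewrite psumr_eq0; last by move=> x _; rewrite if_same.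
    apply/negP => /allP/(_ x1 (mem_index_enum _)); rewrite if_same oner_eq0 implybF.
    by rewrite /between bet eqxx.
  by apply: sumr_ge0 => x _; rewrite if_same.
have wE : w = mean_ratio (i - i') (j - j').
  have nz : (i - i')%:R + (j - j')%:R != 0 :> R by rewrite -natrD pnatr_eq0; lia.
  by rewrite /mean_ratio; apply: (canRL (mulfK nz)); apply/esym/eqP; rewrite -subr_eq0 bal.
have [hV _] := V_cell ip jq.
apply: (le_trans (hV i' j' li lj)); rewrite (sum_below li lj) lerD //.
  by apply: (IH i' j' w) => //; lia.
rewrite block_costE // -wE le_eqVlt; apply/orP; left; apply/eqP.
by apply: eq_bigr => x; rewrite /between bet => /eqP ->.
Qed.

Lemma dp_le_total_monotone : V (class_size true) (class_size false) <= total_dist g.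
Proof.
(* Any threshold above 1 puts every point into the sublevel set. *)
rewrite /total_dist -(eq_bigl _ _ below_all); apply: (dp_le_monotone (c := 2)) => // x.
by rewrite below_all; have /andP[_ h] := g01 x; apply/esym; lra.
Qed.

End Monotone.

(* Rearranging the values of [g] inside each label class into the order of [f]
   keeps [g] balanced and does not increase the distance. *)
Lemma exists_monotone g : exists s : {perm T}, [/\ forall x, one (s x) = one x,
  forall x y, one x = one y -> (rk x <= rk y)%N -> g (s x) <= g (s y)
  & total_dist (g \o s) <= total_dist g].
Proof.
pose keeps (s : {perm T}) := [forall x, one (s x) == one x].
have keeps1 : keeps 1%g by apply/forallP => x; rewrite perm1.
pose td (s : {perm T}) := total_dist (g \o s).
case: (arg_minP td keeps1) => s0 ks0 min0.
(* Among the permutations of least distance, one maximising the sum of rank times value is taken: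
   swapping an inverted pair does not increase the distance and strictly increases this sum. *)
pose opt s := keeps s && (td s == td s0).
have opt0 : opt s0 by rewrite /opt ks0 eqxx.
case: (arg_maxP (fun s : {perm T} => \sum_x (rk x)%:R * g (s x)) opt0) => s /andP[/forallP ks /eqP ts] smax.
exists s; split=> [x|x y xy le|]; first exact/eqP.
- rewrite leNgt; apply/negP => gt.
  have nxy : x != y by apply: contraL gt => /eqP ->; rewrite ltxx.
  have {le}lt : (rk x < rk y)%N.
    by rewrite ltn_neqAle le andbT; apply: contra nxy => /eqP /(rk_inj xy) ->.
  pose t := (tperm x y * s)%g.
  have tx : t x = s y by rewrite permM tpermL.
  have ty : t y = s x by rewrite permM tpermR.
  have tz z : (z != x) && (z != y) -> t z = s z.
    by move=> /andP[zx zy]; rewrite permM tpermD // eq_sym.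
  have split2 (F : T -> R) : \sum_z F z = F x + (F y + \sum_(z | (z != x) && (z != y)) F z).
    by rewrite (bigD1 x) //= (bigD1 y) //= eq_sym.
  have kt : keeps t.
    apply/forallP => z; have [->|zx] := eqVneq z x; first by rewrite tx (eqP (ks y)) xy.
    have [->|zy] := eqVneq z y; first by rewrite ty (eqP (ks x)) xy.
    by rewrite tz ?zx.
  have le_td : td t <= td s.
    rewrite /td /total_dist !split2 /= tx ty.
    rewrite (eq_bigr (fun z => `|f z - g (s z)|)); last by move=> z /tz ->.
    rewrite !addrA lerD2r; have fxy := rk_mono xy (ltnW lt).
    move: (g (s x)) (g (s y)) (f x) (f y) gt fxy => u v p q vu pq.
    (* The uncrossing inequality: for p <= q and v < u, |p - v| + |q - u| <= |p - u| + |q - v|. *)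
    by case: (lerP p v); case: (lerP q u); case: (lerP p u); case: (lerP q v); lra.
  have ot : opt t by rewrite /opt kt eq_le min0 // -ts le_td.
  have : \sum_z (rk z)%:R * g (t z) <= \sum_z (rk z)%:R * g (s z) := smax t ot.
  rewrite leNgt => /negP; apply; rewrite !split2 /= tx ty.
  rewrite [in X in _ < X](eq_bigr (fun z => (rk z)%:R * g (s z))); last by move=> z /tz ->.
  rewrite !addrA ltrD2r -subr_gt0.
  have -> : (rk x)%:R * g (s y) + (rk y)%:R * g (s x) -
     ((rk x)%:R * g (s x) + (rk y)%:R * g (s y)) =
     ((rk y)%:R - (rk x)%:R) * (g (s x) - g (s y)) by ring.
  by rewrite mulr_gt0 // subr_gt0 // ltr_nat.
- rewrite -[total_dist (g \o s)]/(td s) ts; apply: le_trans (min0 _ keeps1) _.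
  by rewrite le_eqVlt; apply/orP; left; apply/eqP; apply: eq_bigr => x _; rewrite /= perm1.
Qed.

Lemma dp_le_balanced g : (forall x, 0 <= g x <= 1) -> balanced g ->
  V (class_size true) (class_size false) <= total_dist g.
Proof.
move=> g01 gb; have [s [so sm st]] := exists_monotone g.
apply: le_trans st; apply: dp_le_total_monotone => [x|alpha|//]; first exact: g01.
rewrite -[RHS](gb alpha) [RHS](reindex_inj (@perm_inj _ s)) /=.
by apply: eq_bigr => x _; rewrite so.
Qed.

End Noiseless.

(** * The exact algorithm: table addresses and programs *)

(** A pairing without the halving of Cantor's: the code lies between (i + j)^2 and (i + j + 1)^2 -
    1, which determines i + j and then i. Addresses may be sparse, as access costs the same
    everywhere. *)
Definition pair_code (i j : nat) : nat := ((i + j) * (i + j) + i)%N.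

Lemma pair_code_eq i j k l :
  (pair_code i j == pair_code k l) = (i == k) && (j == l).
Proof.
apply/eqP/andP => [e|[/eqP -> /eqP ->] //].
have h : (i + j = k + l)%N.
  move: e; rewrite /pair_code; have [|lt|//] := ltngtP (i + j) (k + l)%N.
    move=> lt; have : ((i + j).+1 * (i + j).+1 <= (k + l) * (k + l))%N by exact: leq_mul.
    by nia.
  have : ((k + l).+1 * (k + l).+1 <= (i + j) * (i + j))%N by exact: leq_mul.
  by nia.
have ik : i = k by move: e; rewrite /pair_code h; lia.
by rewrite ik; split => //; apply/eqP; lia.
Qed.

Definition triple_code (i j k : nat) : nat := pair_code (pair_code i j) k.

Lemma triple_code_eq i j k i' j' k' : (triple_code i j k == triple_code i' j' k') =
  [&& i == i', j == j' & k == k'].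
Proof. by rewrite /triple_code !pair_code_eq andbA. Qed.

Definition NPair (e1 e2 : nexp) : nexp :=
  NAdd (NMul (NAdd e1 e2) (NAdd e1 e2)) e1.
Definition NTriple (e1 e2 e3 : nexp) : nexp := NPair (NPair e1 e2) e3.
Definition n_plus_1 : nexp := NAdd (NV 0) (NC 1).
Definition incr (x : nat) : prog := PSetN x (NAdd (NV x) (NC 1)).

(* [y] precedes [x] in the order of [f], with ties broken by the index. *)
Definition before_cond (y x : nat) : cexp :=
  CNot (CAnd (CNot (CAnd (CLeN (NAdd (NV y) (NC 1)) (NV x))
                         (CLeX (f_at (NV y)) (f_at (NV x)))))
             (CLeX (f_at (NV x)) (f_at (NV y)))).

(** In the uniform noiseless case the mass of label 1 at a point is 0 or [1/n], so equal masses mean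
    equal labels. *)
Definition same_label (y x : nat) : cexp :=
  CAnd (CLeX (ones_at (NV y)) (ones_at (NV x))) (CLeX (ones_at (NV x)) (ones_at (NV y))).

(* Arrays: 1 holds the ranks, 2 and 3 the prefix costs of the labels 0 and 1, and
   4 the table. *)
Definition rank_prog : prog :=
  PFor 2 (NV 0) (
    PSetX 1 (NV 2) (XN (NC 0)) ;;
    PFor 3 (NV 0) (
      PIf (CAnd (same_label 3 2) (before_cond 3 2))
        (PSetX 1 (NV 2) (XAdd (XR 1 (NV 2)) (XN (NC 1)))) PSkip)).

Definition size_prog : prog :=
  PSetN 6 (NC 0) ;; PSetN 7 (NC 0) ;;
  PFor 2 (NV 0) (PIf (CLeX (ones_at (NV 2)) (XN (NC 0))) (incr 7) (incr 6)).

Definition prefix_prog : prog :=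
  let idx := NTriple (NV 2) (NV 3) (NV 4) in
  let al := XDiv (XN (NV 2)) (XAdd (XN (NV 2)) (XN (NV 3))) in
  PFor 2 n_plus_1 (PFor 3 n_plus_1 (PFor 4 n_plus_1 (
    PSetX 2 idx (XN (NC 0)) ;;
    PSetX 3 idx (XN (NC 0)) ;;
    PFor 5 (NV 0) (
      PIf (CLeX (XAdd (XR 1 (NV 5)) (XN (NC 1))) (XN (NV 4)))
        (PIf (CLeX (ones_at (NV 5)) (XN (NC 0)))
          (add_abs 2 idx (XN (NC 1)) (f_at (NV 5)) al)
          (add_abs 3 idx (XN (NC 1)) (f_at (NV 5)) al))
        PSkip)))).

Definition cell_prog : prog :=
  let prefix r k := XR r (NTriple (NSub (NV 2) (NV 4)) (NSub (NV 3) (NV 5)) (NV k)) in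
  PSetX 4 (NPair (NV 2) (NV 3)) (XN (NAdd (NV 2) (NV 3))) ;;
  PFor 4 (NAdd (NV 2) (NC 1)) (PFor 5 (NAdd (NV 3) (NC 1)) (
    PSetX 5 (NC 0) (XAdd (XR 4 (NPair (NV 4) (NV 5)))
      (XAdd (XSub (prefix 3 2) (prefix 3 4)) (XSub (prefix 2 3) (prefix 2 5)))) ;;
    PIf (CLeX (xvar 5) (XR 4 (NPair (NV 2) (NV 3))))
      (PSetX 4 (NPair (NV 2) (NV 3)) (xvar 5)) PSkip)).

Definition exact_prog : prog :=
  rank_prog ;; size_prog ;; prefix_prog ;;
  PFor 2 n_plus_1 (PFor 3 n_plus_1 cell_prog) ;;
  PSetX 5 (NC 0) (XDiv (XR 4 (NPair (NV 6) (NV 7))) (XN (NV 0))).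

(** * Correctness of the exact program *)

Section Exact.
Variables (R : realType) (n : nat) (inp : nat -> R).
Local Notation M := n.+1.
Local Notation d1 := (fun i => inp (n + i)%N).
Local Notation ff := (fun i => inp (2 * n + i)%N).

Definition positive_label (x : nat) : bool := ~~ (d1 x <= 0).

Definition before (y x : nat) : bool := ~~ (~~ ((y < x)%N && (ff y <= ff x)) && (ff x <= ff y)).

Definition rank (x : nat) : nat :=
  \sum_(y < n | (d1 y == d1 x) && before y x) 1.

Definition prefix_sum (b : bool) (al : R) (i : nat) : R :=
  \sum_(x < n | (positive_label x == b) && (rank x < i)%N) `|ff x - al|.

Definition exact_env (a : astate R) : Prop := nv a 0 = n /\ xr a 0 = inp.

Lemma wp_rank a : exact_env a ->
  wp M rank_prog (fun a' => forall x, (x < n)%N -> xr a' 1 x = (rank x)%:R) a.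
Proof.
move=> [a0 ax].
apply: (@wp_for _ _ n (fun k a' => forall x, (x < k)%N -> xr a' 1 x = (rank x)%:R)) => //.
move=> k a1 kn [Fn1 Fx1] I1.
apply: wp_seq; apply: wp_setx.
apply: (@wp_for _ _ n (fun l a' => xr a' 1 k =
   (\sum_(y < l | (d1 y == d1 k) && before y k) 1)%:R /\
   forall x, (x < k)%N -> xr a' 1 x = (rank x)%:R)) => //.
- by rewrite /= Fn1.
- rewrite /= eqxx big_ord0; split=> // x xk.
  by rewrite (ltn_eqF xk) I1.
- move=> l a2 ln [Fn2 Fx2] [I2 I2'].
  have b0 : nv a2 0 = n by rewrite Fn2 //= Fn1.
  have b2 : nv a2 2 = k by rewrite Fn2.
  have bx : xr a2 0 = inp by rewrite Fx2 //= Fx1.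
  apply: wp_if; rewrite [ceval _ _]/= b0 b2 bx addn1 -eq_le.
    move=> c; apply: wp_setx; split=> [|x xk] /=; rewrite b2.
      by rewrite eqxx I2 [in RHS]big_mkcond big_ord_recr /= [in RHS]c -big_mkcond natrD.
    by rewrite (ltn_eqF xk) I2'.
  move=> c; split=> //=.
  by rewrite I2 [in RHS]big_mkcond big_ord_recr /= (negbTE c) addn0 -big_mkcond.
- move=> a2 _ [I2 I2'] x; rewrite ltnS leq_eqVlt => /orP[/eqP ->|/I2' //].
  exact: I2.
Qed.

Lemma wp_size a : exact_env a -> wp M size_prog (fun a' =>
   nv a' 6 = (\sum_(x < n | positive_label x == true) 1)%N /\
   nv a' 7 = (\sum_(x < n | positive_label x == false) 1)%N) a.
Proof.
move=> [a0 ax]; apply: wp_seq; apply: wp_setn; apply: wp_seq; apply: wp_setn.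
apply: (@wp_for _ _ n (fun k a' =>
   nv a' 6 = (\sum_(x < k | positive_label x == true) 1)%N /\
   nv a' 7 = (\sum_(x < k | positive_label x == false) 1)%N)) => //.
- by rewrite /= !big_ord0.
- move=> k a1 kn [Fn1 Fx1] [I1 I2].
  have e b : (\sum_(x < k.+1 | positive_label x == b) 1 =
     \sum_(x < k | positive_label x == b) 1 + (positive_label k == b))%N.
    by rewrite big_mkcond big_ord_recr /= -big_mkcond; case: (_ == b).
  rewrite !e; apply: wp_if; rewrite [ceval _ _]/= (Fn1 0%N) //= a0 Fx1 //= ax => h;
    apply: wp_setn => /=; rewrite I1 I2 /positive_label h /=; first by rewrite addn0.
  by rewrite addn0.
Qed.

Definition prefix_ok (a : astate R) (di dj i : nat) : Prop :=
  xr a 2 (triple_code di dj i) = prefix_sum false (mean_ratio R di dj) i /\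
  xr a 3 (triple_code di dj i) = prefix_sum true (mean_ratio R di dj) i.

Lemma wp_prefix a : exact_env a -> (forall x, (x < n)%N -> xr a 1 x = (rank x)%:R) ->
  wp M prefix_prog (fun a' => forall di dj i, (di <= n)%N -> (dj <= n)%N -> (i <= n)%N ->
     prefix_ok a' di dj i) a.
Proof.
move=> [a0 ax] ar.
apply: (@wp_for _ _ n.+1 (fun k a' => forall di dj i, (di < k)%N -> (dj <= n)%N ->
   (i <= n)%N -> prefix_ok a' di dj i)) => //=; first by rewrite a0 addn1.
move=> di a1 ltdi [Fn1 Fx1] I1.
apply: (@wp_for _ _ n.+1 (fun l a' => forall di' dj i,
   ((di' < di) || (di' == di) && (dj < l))%N -> (dj <= n)%N -> (i <= n)%N ->
   prefix_ok a' di' dj i)) => //=; first by rewrite Fn1 // a0 addn1.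
  by move=> di' dj i; rewrite andbF orbF; exact: I1.
move=> dj a2 ltdj [Fn2 Fx2] I2.
apply: (@wp_for _ _ n.+1 (fun m a' => forall di' dj' i,
   ((di' < di) || (di' == di) && ((dj' < dj) || (dj' == dj) && (i < m)))%N ->
   (dj' <= n)%N -> (i <= n)%N -> prefix_ok a' di' dj' i)) => //=.
- by rewrite Fn2 //= Fn1 // a0 addn1.
- by move=> di' dj' i; rewrite andbF orbF; exact: I2.
- move=> i a3 lti [Fn3 Fx3] I3.
  apply: wp_seq; apply: wp_setx; apply: wp_seq; apply: wp_setx.
  set tc := triple_code di dj i.
  pose S b l := \sum_(x < l | (positive_label x == b) && (rank x < i)%N) `|ff x - mean_ratio R di dj|.
  have idxE (b : astate R) : nv b 2 = di -> nv b 3 = dj -> nv b 4 = i ->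
      neval b (NTriple (NV 2) (NV 3) (NV 4)) = tc.
    by move=> /= -> -> ->.
  have e2 : nv (setn a3 4 i) 2 = di by rewrite /= Fn3 //= Fn2.
  have e3 : nv (setn a3 4 i) 3 = dj by rewrite /= Fn3.
  apply: (@wp_for _ _ n (fun l a' => xr a' 2 tc = S false l /\ xr a' 3 tc = S true l /\
    forall u, u != tc -> xr a' 2 u = xr a3 2 u /\ xr a' 3 u = xr a3 3 u)) => //.
  + by rewrite /= Fn3 //= Fn2 //= Fn1.
  + rewrite /S !big_ord0 (idxE (setn a3 4 i) e2 e3 erefl).
    rewrite (idxE (setx (setn a3 4 i) _ _ _) e2 e3 erefl) /= !eqxx.
    by split=> //; split=> // u /negbTE ->.
  + move=> l a4 ln [Fn4 Fx4] [I41 [I42 I43]].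
    have b0 : nv a4 0 = n by rewrite Fn4 //= Fn3 //= Fn2 //= Fn1.
    have b2 : nv a4 2 = di by rewrite Fn4.
    have b3 : nv a4 3 = dj by rewrite Fn4.
    have b4 : nv a4 4 = i by rewrite Fn4.
    have bx : xr a4 0 = inp by rewrite Fx4 //= Fx3 //= Fx2 //= Fx1.
    have br : xr a4 1 l = (rank l)%:R by rewrite Fx4 //= Fx3 //= Fx2 //= Fx1 //= ar.
    have SE b : S b l.+1 = S b l + (if (positive_label l == b) && (rank l < i)%N
        then `|ff l - mean_ratio R di dj| else 0).
      by rewrite /S big_mkcond big_ord_recr /= -big_mkcond.
    rewrite !SE; apply: wp_if; rewrite [ceval _ _]/= br b4 natr1 ler_nat => ri.
      apply: wp_if; rewrite [ceval _ _]/= b0 bx => pl; apply: wp_add_abs;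
        rewrite (idxE (setn a4 5 l) b2 b3 b4) /= eqxx b0 bx b2 b3 mul1r;
        rewrite /positive_label pl ri /= I41 I42 addr0; split=> //; split=> // u ut;
        by rewrite (negbTE ut); exact: I43.
    by rewrite (negbTE ri) !andbF !addr0.
  move=> a4 [Fn4 Fx4] [I41 [I42 I43]] di' dj' i'.
  rewrite /prefix_ok; have := triple_code_eq di' dj' i' di dj i; case: eqP => [e _|ne hne].
    rewrite /= e; have /eqP := e; rewrite triple_code_eq => /and3P[/eqP -> /eqP -> /eqP ->].
    by move=> _ _ _; rewrite I41 I42.
  move=> h hj hi; have [-> ->] : xr a4 2 (triple_code di' dj' i') = xr a3 2 (triple_code di' dj' i')
     /\ xr a4 3 (triple_code di' dj' i') = xr a3 3 (triple_code di' dj' i').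
    by apply: I43; exact/eqP.
  by apply: I3 => //; move: h hne; lia.
- move=> a3 _ I3 di' dj' i h hj hi; apply: I3 => //; move: h hi; lia.
by move=> a2 _ I2 di' dj' i h hj hi; apply: I2 => //; move: h hj; lia.
Qed.

(** [block_cost] for the type 'I_n unfolds to this. *)
Definition cost_of (i' j' i j : nat) : R :=
  let al := mean_ratio R (i - i') (j - j') in
  (prefix_sum true al i - prefix_sum true al i') +
  (prefix_sum false al j - prefix_sum false al j').

Definition cell_ok (V : nat -> nat -> R) (i j : nat) : Prop :=
  (forall i' j', (i' <= i)%N -> (j' <= j)%N -> V i j <= V i' j' + cost_of i' j' i j) /\
  (V i j = (i + j)%:R \/ exists i' j', [/\ (i' <= i)%N, (j' <= j)%N,
     (i' + j' < i + j)%N & V i j = V i' j' + cost_of i' j' i j]).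

Definition table (a : astate R) (i j : nat) : R := xr a 4 (pair_code i j).

Lemma cost_of_self i j : cost_of i j i j = 0.
Proof. by rewrite /cost_of !subrr addr0. Qed.

Lemma wp_cell a i j : (i <= n)%N -> (j <= n)%N ->
  (forall di dj k, (di <= n)%N -> (dj <= n)%N -> (k <= n)%N -> prefix_ok a di dj k) ->
  nv a 2 = i -> nv a 3 = j ->
  wp M cell_prog (fun a' => cell_ok (table a') i j /\
    forall i' j', (i', j') != (i, j) -> table a' i' j' = table a i' j') a.
Proof.
move=> i_n j_n pre a2 a3; apply: wp_seq; apply: wp_setx.
pose V := table a.
(* The strict decrease of i' + j' is kept in the invariant, since the later induction over cells
   rests on it. *)
pose P (T : nat -> nat -> R) :=
  (forall i' j', (i', j') != (i, j) -> T i' j' = V i' j') /\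
  (T i j = (i + j)%:R \/ exists i' j', [/\ (i' <= i)%N, (j' <= j)%N,
     (i' + j' < i + j)%N & T i j = T i' j' + cost_of i' j' i j]).
have offdiag k l : (k <= i)%N -> (l <= j)%N -> (k, l) != (i, j) -> (k + l < i + j)%N.
  by rewrite xpair_eqE negb_and => ? ? /orP[]; lia.
apply: (@wp_for _ _ i.+1 (fun k a' => P (table a') /\
   forall i' j', (i' < k)%N -> (j' <= j)%N -> table a' i j <= table a' i' j' + cost_of i' j' i j)).
- by rewrite /= a2 addn1.
- by rewrite ltnS.
- split=> //; split=> // [i' j' ne|].
    by rewrite /table /= a2 a3 -/(pair_code i j) pair_code_eq -xpair_eqE (negbTE ne).
  by left; rewrite /table /= a2 a3 eqxx.
- move=> k b ki [Fn1 Fx1] [Pb Ib].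
  apply: (@wp_for _ _ j.+1 (fun l a' => P (table a') /\
   forall i' j', ((i' < k) || (i' == k) && (j' < l))%N -> (j' <= j)%N ->
     table a' i j <= table a' i' j' + cost_of i' j' i j)).
  + by rewrite /= Fn1 //= a3 addn1.
  + by rewrite ltnS.
  + by split=> // i' j'; rewrite andbF orbF; exact: Ib.
  + move=> l c lj [Fn2 Fx2] [Pc Ic].
    have e2 : nv c 2 = i by rewrite Fn2 //= Fn1.
    have e3 : nv c 3 = j by rewrite Fn2 //= Fn1.
    have e4 : nv c 4 = k by rewrite Fn2.
    have x2 : xr c 2 = xr a 2 by rewrite Fx2 //= Fx1.
    have x3 : xr c 3 = xr a 3 by rewrite Fx2 //= Fx1.
    apply: wp_seq; apply: wp_setx; set c' := setx _ 5 _ _.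
    have cand : xr c' 5 0 = table c k l + cost_of k l i j.
      rewrite /c' /= e2 e3 e4 x2 x3 -!/(pair_code _ _) -!/(triple_code _ _ _).
      have [_ ->] := pre (i - k)%N (j - l)%N i ltac:(lia) ltac:(lia) i_n.
      have [_ ->] := pre (i - k)%N (j - l)%N k ltac:(lia) ltac:(lia) ltac:(lia).
      have [-> _] := pre (i - k)%N (j - l)%N j ltac:(lia) ltac:(lia) j_n.
      by have [-> _] := pre (i - k)%N (j - l)%N l ltac:(lia) ltac:(lia) ltac:(lia).
    have tc : table c' = table c by [].
    have f2 : nv c' 2 = i by [].
    have f3 : nv c' 3 = j by [].
    move: c' cand tc f2 f3 => c' cand tc f2 f3.
    have tij : xr c' 4 (neval c' (NPair (NV 2) (NV 3))) = table c i j.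
      by rewrite -tc /= f2 f3.
    apply: wp_if; rewrite [ceval _ _]/= -/(neval c' (NPair (NV 2) (NV 3))) tij cand => le.
      apply: wp_setx; set c2 := setx _ 4 _ _.
      have t2 i' j' : table c2 i' j' = if (i', j') == (i, j) then
          table c k l + cost_of k l i j else table c i' j'.
        by rewrite /table /c2 /= f2 f3 -/(pair_code i j) pair_code_eq -xpair_eqE cand -/(table c' i' j') tc.
      move: Pc => [P1 P2].
      (* The loops also try the cell itself as its predecessor. That candidate has block cost 0, so
         writing it changes nothing. *)
      case: (eqVneq (k, l) (i, j)) => [[ek el]|ne].
        have tt : table c2 = table c.
          apply: funext => i'; apply: funext => j'; rewrite t2; case: eqP => [[-> ->]|//].
          by rewrite ek el cost_of_self addr0.
        rewrite tt; split=> // i' j' h hj.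
        case: (eqVneq (i', j') (i, j)) => [[-> ->]|ne]; first by rewrite cost_of_self addr0.
        by apply: Ic => //; move: ne; rewrite xpair_eqE; move: h; rewrite ek el; lia.
      split.
        split=> // [i' j' ne'|]; first by rewrite t2 (negbTE ne') P1.
        right; exists k, l; split; [lia|lia|by apply: offdiag; lia|].
        by rewrite !t2 eqxx (negbTE ne).
      move=> i' j' h hj; rewrite !t2 eqxx.
      case: ifP => [/eqP[-> ->]|ne']; first by rewrite cost_of_self addr0.
      case: (eqVneq (i', j') (k, l)) => [[-> ->] //|ne2].
      by apply: (le_trans le); apply: Ic => //; move: ne2; rewrite xpair_eqE; move: h; lia.
    change (P (table c') /\
      forall i' j', ((i' < k) || (i' == k) && (j' < l.+1))%N -> (j' <= j)%N ->
      table c' i j <= table c' i' j' + cost_of i' j' i j).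
    rewrite tc; split=> // i' j' h hj.
    case: (eqVneq (i', j') (k, l)) => [[-> ->]|ne2]; first by rewrite ltW // ltNge.
    by apply: Ic => //; move: ne2; rewrite xpair_eqE; move: h; lia.
  + move=> c _ [Pc Ic]; split=> // i' j' h hj; apply: Ic => //.
    by move: h hj; lia.
- move=> b _ [[P1 P2] Ib]; split=> //; split=> // i' j' h hj; exact: Ib.
Qed.

Lemma cell_ok_eq V V' i j : (forall i' j', (i' <= i)%N -> (j' <= j)%N -> V' i' j' = V i' j') ->
  cell_ok V i j -> cell_ok V' i j.
Proof.
move=> e [h1 h2]; split=> [i' j' hi hj|]; first by rewrite !e // h1.
case: h2 => [h|[i' [j' [hi hj hl h]]]]; [left | right; exists i', j'; split=> //]; by rewrite !e.
Qed.

Definition label_count (b : bool) : nat := \sum_(x < n | positive_label x == b) 1.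

Lemma label_count_le b : (label_count b <= n)%N.
Proof.
rewrite /label_count sum1_card; apply: leq_trans (max_card _) _; by rewrite card_ord.
Qed.

Lemma wp_exact a : exact_env a -> wp M exact_prog (fun a' => exists V : nat -> nat -> R,
  (forall i j, (i <= n)%N -> (j <= n)%N -> cell_ok V i j) /\
  xr a' 5 0 = V (label_count true) (label_count false) / n%:R) a.
Proof.
move=> env; have fr p b b' : exact_env b -> frame p b b' ->
    0%N \notin nwrites p -> 0%N \notin xwrites p -> exact_env b'.
  by move=> [h1 h2] [Fn Fx] w1 w2; split; rewrite ?Fn ?Fx.
apply: wp_seq; apply: wp_frame; first exact: wp_rank.
move=> a1 F1 r1; have {}env := fr _ _ _ env F1 isT isT.
apply: wp_seq; apply: wp_frame; first exact: wp_size.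
move=> a2 F2 /= [p2 q2]; have {F1}env := fr _ _ _ env F2 isT isT.
have r2 x : (x < n)%N -> xr a2 1 x = (rank x)%:R.
  by have [_ Fx2] := F2; move=> xn; rewrite Fx2 // r1.
apply: wp_seq; apply: wp_frame; first exact: wp_prefix.
move=> a3 F3 pre; have {}env := fr _ _ _ env F3 isT isT.
have p3 : nv a3 6 = label_count true by have [-> //] := F3.
have q3 : nv a3 7 = label_count false by have [-> //] := F3.
have n3 : nv a3 0 = n by case: env.
apply: wp_seq; apply: (@wp_for _ _ n.+1 (fun k a' => forall i j, (i < k)%N -> (j <= n)%N ->
   cell_ok (table a') i j)) => //; first by rewrite /= n3 addn1.
  move=> i a4 lti [Fn4 Fx4] I4.
  apply: (@wp_for _ _ n.+1 (fun l a' => forall i' j, ((i' < i) || (i' == i) && (j < l))%N ->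
     (j <= n)%N -> cell_ok (table a') i' j)) => //; first by rewrite /= Fn4 // n3 addn1.
    by move=> i' j; rewrite andbF orbF; exact: I4.
    move=> j a5 ltj [Fn5 Fx5] I5.
    apply: wp_frame; first apply: (@wp_cell _ i j) => //.
    - move=> di dj k h1 h2 h3; have [e1 e2] := pre di dj k h1 h2 h3.
      by split=> /=; rewrite Fx5 //= Fx4.
    - by rewrite /= Fn5.
    move=> a6 _ [ok6 same6] i' j' h hj'.
    case: (eqVneq (i', j') (i, j)) => [[-> ->] //|ne].
    apply: (@cell_ok_eq (table a5)).
      move=> i2 j2 h1 h2; rewrite same6 //; move: ne h; rewrite !xpair_eqE; lia.
    by apply: I5 => //; move: ne h; rewrite xpair_eqE; lia.
  by move=> a5 _ I5 i' j h hj; apply: I5 => //; move: h hj; lia.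
move=> a4 [Fn4 Fx4] I4; apply: wp_setx; exists (table a4); split.
  by move=> i j hi hj; apply: I4.
by rewrite /= !Fn4 //= p3 q3 n3.
Qed.

End Exact.

Definition exact_alg : cmd := run exact_prog 5.
(** Loops make up to n + 1 <= 2n rounds at depth 4, hence the factor 16. *)
Definition exact_constant : nat := (tbound 1 exact_prog + 600) * 16.

(** * From uniform noiseless distributions to labels, ranks and balance *)

Section ExactAlg.
Variables (R : realType) (X : finType) (D : fdist R (X * bool)%type) (f : X -> R).
Hypothesis pf : predictor f.
Hypothesis unif : uniform D.
Hypothesis noisel : noiseless D.
Local Notation n := #|X|.
Local Notation inp := (rmem (input D f [::])).
Local Notation d0 := inp.
Local Notation d1 := (fun i => inp (n + i)%N).
Local Notation ff := (fun i => inp (2 * n + i)%N).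

Let one (i : 'I_n) : bool := positive_label n inp i.
Let rk (i : 'I_n) : nat := rank n inp i.

Let n_gt0 : 0 < n%:R :> R. Proof. by rewrite ltr0n (card_X_gt0 D). Qed.

Lemma mass_uniform i : (i < n)%N -> inp i + inp (n + i)%N = n%:R^-1.
Proof.
by have [x0] := X_inhabited D; move=> /(inpE D f [::] x0)[-> -> _]; rewrite -marginalE unif.
Qed.

Lemma label_noiseless (i : 'I_n) : inp (n + i)%N = (one i)%:R / n%:R.
Proof.
have [x0] := X_inhabited D; have [_ e _] := inpE D f [::] x0 (ltn_ord i).
rewrite /one /positive_label e; set x := nth x0 (enum X) i.
have muE : mu D x = D (x, true) / marginal D x.
  by rewrite /mu /cPr (Pr_true D (pred1 x)) big_pred1_eq.
have := noisel x; rewrite muE unif => -[] /(congr1 (fun u => u * n%:R^-1));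
  rewrite mulfVK ?invr_eq0 ?gt_eqF // => ->.
  by rewrite mul0r lexx mul0r.
by rewrite mul1r -ltNge invr_gt0 n_gt0 mul1r.
Qed.

Lemma same_labelE (y x : 'I_n) : (inp (n + y)%N == inp (n + x)%N) = (one y == one x).
Proof.
rewrite !label_noiseless; case: (one y); case: (one x);
  by rewrite ?eqxx // ?mul0r ?mul1r ?(eq_sym 0) invr_eq0 gt_eqF.
Qed.

Lemma beforeE y x : before n inp y x =
  (inp (2 * n + y)%N < inp (2 * n + x)%N) ||
  (y < x)%N && (inp (2 * n + y)%N <= inp (2 * n + x)%N).
Proof. by rewrite /before negb_and negbK orbC -ltNge. Qed.

Lemma before_trans y x z : before n inp x y -> before n inp y z -> before n inp x z.
Proof.
rewrite !beforeE => /orP[xy|/andP[xy fxy]] /orP[yz|/andP[yz fyz]]; apply/orP.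
- by left; exact: lt_trans xy yz.
- by left; exact: lt_le_trans xy fyz.
- by left; exact: le_lt_trans fxy yz.
- by right; rewrite (ltn_trans xy yz) (le_trans fxy fyz).
Qed.

Lemma before_irr x : ~~ before n inp x x.
Proof. by rewrite beforeE ltxx ltnn. Qed.

Lemma before_total (x y : 'I_n) : x != y -> before n inp x y || before n inp y x.
Proof.
rewrite -val_eqE !beforeE neq_ltn => xy.
by case: (ltgtP (inp (2 * n + x)%N) (inp (2 * n + y)%N)) => /= _;
  rewrite ?andbT ?orbT.
Qed.

Lemma rkE x : rk x = #|[pred y | (one y == one x) && before n inp y x]|.
Proof.
rewrite -sum1_card; apply: eq_bigl => y.
by rewrite inE same_labelE.
Qed.

Lemma rk_before x y : one x = one y -> before n inp x y -> (rk x < rk y)%N.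
Proof.
move=> xy bxy; rewrite !rkE; apply: proper_card; apply/properP; split.
  apply/fintype.subsetP => z; rewrite !inE -xy => /andP[-> zx] /=.
  exact: before_trans zx bxy.
by exists x; rewrite !inE ?xy ?eqxx ?bxy // (negbTE (before_irr x)) andbF.
Qed.

Lemma rk_injective x y : one x = one y -> rk x = rk y -> x = y.
Proof.
move=> xy e; apply/eqP; apply: contraT => /before_total /orP[] h.
  by have := rk_before xy h; rewrite e ltnn.
by have := rk_before (esym xy) h; rewrite e ltnn.
Qed.

Lemma rk_monotone x y : one x = one y -> (rk x <= rk y)%N -> ff x <= ff y.
Proof.
move=> xy; apply: contraTT; rewrite -ltNge -ltnNge => lt.
by apply: rk_before => //; rewrite beforeE lt.
Qed.

Lemma rk_lt_size x : (rk x < class_size one (one x))%N.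
Proof.
rewrite rkE; apply: proper_card; apply/properP; split.
  by apply/fintype.subsetP => z; rewrite !inE => /andP[].
by exists x; rewrite !inE ?eqxx // (negbTE (before_irr x)).
Qed.

Lemma cal_of_balanced (g : 'I_n -> R) : (forall x, 0 <= g x <= 1) -> balanced one g ->
  exists2 h, cal n d0 d1 h & cost n d0 d1 ff h = total_dist (fun i : 'I_n => ff i) g / n%:R.
Proof.
move=> g01 gb; pose h k := if insub k is Some x then g x else 0.
have hE (i : 'I_n) : h i = g i by rewrite /h valK.
exists h.
  split=> [i i_n|alpha]; first by rewrite (hE (Ordinal i_n)).
  transitivity (\sum_(x | g x == alpha) ((one x)%:R - alpha) / n%:R).
    apply: eq_big => [i|i _]; first by rewrite hE.
    by rewrite mass_uniform // label_noiseless mulrBl.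
  by rewrite -mulr_suml gb mul0r.
rewrite /cost /total_dist mulr_suml; apply: eq_bigr => i _.
by rewrite mass_uniform // hE mulrC.
Qed.

Lemma balanced_of_cal h : cal n d0 d1 h ->
  balanced one (fun i : 'I_n => h i) /\
  cost n d0 d1 ff h = total_dist (fun i : 'I_n => ff i) (fun i : 'I_n => h i) / n%:R.
Proof.
move=> [h01 hc]; split=> [alpha|].
  apply: (mulIf (_ : n%:R^-1 != 0)); first by rewrite invr_eq0 gt_eqF.
  rewrite mul0r -[RHS](hc alpha) mulr_suml; apply: eq_bigr => i _.
  by rewrite mass_uniform // label_noiseless mulrBl.
rewrite /cost /total_dist mulr_suml; apply: eq_bigr => i _.
by rewrite mass_uniform // mulrC.
Qed.

Lemma exact_correct : exists t, computes_in exact_alg (input D f [::]) t (CalDist D f) /\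
  (t <= exact_constant * n ^ 4)%N.
Proof.
have n0 := card_X_gt0 D.
have [|||t [a [ex ht [V [V_ok out]]]]] := @run_sound _ _ D f [::] exact_prog 5 n.+1
  _ _ _ _ (ltnSn n) (fun a a0 ax => wp_exact (conj a0 ax)).
- by [].
- by [].
- by [].
exists t; split; last first.
  apply: (leq_trans ht); rewrite -[maxn _ _]/4%N /exact_constant -mulnA leq_mul2l.
  by apply/orP; right; rewrite -[16%N]/(2 ^ 4)%N -expnMn leq_exp2r //; lia.
have size_count b : class_size one b = label_count n inp b.
  by rewrite /class_size /label_count sum1_card.
have cells i j : (i <= class_size one true)%N -> (j <= class_size one false)%N ->
    dp_cell one (fun i : 'I_n => ff i) rk V i j.
  rewrite !size_count => hi hj; apply: V_ok.
    exact: leq_trans hi (label_count_le _ _ _).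
  exact: leq_trans hj (label_count_le _ _ _).
have f01 (x : 'I_n) : 0 <= ff x <= 1 by exact: (@inp_f01 _ _ D f [::] pf _ (ltn_ord x)).
have [g [g01 gb gV]] := exists_balanced f01 rk_injective rk_lt_size cells.
suff -> : CalDist D f = xr a 5 0 by [].
apply/esym/eqP; rewrite out -!size_count -subr_eq0 -normr_le0.
apply: (@CalDist_approx _ _ _ _ [::]) => [h ch|].
  have [hb ->] := balanced_of_cal ch; have [h01 _] := ch.
  rewrite addr0 ler_pM2r ?invr_gt0 //.
  by apply: (dp_le_balanced rk_injective rk_monotone rk_lt_size cells) => // x; exact: h01.
have [h ch hc] := cal_of_balanced g01 gb; exists h => //.
by rewrite addr0 hc ler_pM2r ?invr_gt0.
Qed.

End ExactAlg.

Theorem theorem1p1 (R : realType) :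
  (exists (alg : cmd) (C : nat),
     forall (X : finType) (D : fdist R (X * bool)%type) (f : X -> R),
       predictor f -> uniform D -> noiseless D ->
       exists t : nat,
         computes_in alg (input D f [::]) t (CalDist D f) /\
         (t <= C * #|X| ^ 4)%N)
  /\
  (exists (alg : cmd) (A B : nat),
     forall (X : finType) (D : fdist R (X * bool)%type) (f : X -> R) (eps : R),
       predictor f -> uniform D -> 0 < eps ->
       exists (t : nat) (v : R),
         [/\ computes_in alg (input D f [:: eps]) t v,
             `|v - CalDist D f| <= eps
           & t%:R <= A%:R * #|X|%:R `^ (B%:R / eps)])
  /\
  (exists (alg : cmd) (A B : nat),
     forall (X : finType) (D : fdist R (X * bool)%type) (f : X -> R) (eps : R),
       predictor f -> 0 < eps ->
       exists (t : nat) (v : R),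
         [/\ computes_in alg (input D f [:: eps]) t v,
             `|v - CalDist D f| <= eps
           & t%:R <= A%:R * (#|X|%:R / eps) `^ (B%:R / eps)]).
Proof.
split; last split.
- exists exact_alg, exact_constant => X D f pf unif noisel.
  exact: exact_correct.
- exists approx_alg, approx_constant, (40 * approx_degree)%N => X D f eps pf _.
  exact: approx_uniform.
- have [A hA] := approx_general R.
  by exists approx_alg, A, (40 * approx_degree)%N.
Qed.
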